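(* Let $(a,b)\in\mathbb{R}^2$ with $a<b$, let $f\in L^1([a,b];\mathbb{R})$ and let $\alpha>0$. Then $$\mathcal{D}_a^\alpha\left(S_a^\alpha f\right)(x)=f(x),\quad \text{for a.e. } x\in[a,b].$$
   Context: Let $E_1(x)=\int_x^\infty \frac{e^{-t}}{t}\,dt$ for $x>0$ and $\mathcal{S}(t)=e^{-t}\int_0^\infty \frac{t^{s-1}}{\Gamma(s)}\,ds$ for $t>0$, where $\Gamma$ is the Gamma function. For $\alpha>0$ and $f\in L^1([a,b];\mathbb{R})$, define for a.e. $x\in[a,b]$ $$(J_a^\alpha f)(x)=\frac{1}{\alpha}\int_a^x E_1\left(\frac{x-t}{\alpha}\right)f(t)\,dt,\qquad (S_a^\alpha f)(x)=\int_a^x \mathcal{S}\left(\frac{x-t}{\alpha}\right)f(t)\,dt.$$ A function in $L^1([a,b];\mathbb{R})$ has an absolutely continuous representative if it coincides a.e. on $[a,b]$ with an absolutely continuous function on $[a,b]$; it is then identified with that function. If $J_a^\alpha f$ has an absolutely continuous representative, the left-sided fractional derivative of order $\alpha$ of $f$ is $(\mathcal{D}_a^\alpha f)(x)=\frac{d}{dx}(J_a^\alpha f)(x)$ for a.e. $x\in[a,b]$. *)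

(* Defs.v *)
From HB Require Import structures.
From mathcomp Require Import all_boot all_order all_algebra.
From mathcomp Require Import all_classical all_reals all_analysis.

Set Implicit Arguments.
Unset Strict Implicit.
Unset Printing Implicit Defensive.
Import Order.TTheory GRing.Theory Num.Theory.
Import numFieldNormedType.Exports.
Local Open Scope classical_set_scope.
Local Open Scope ring_scope.

(* The integrals below are real-valued (Rintegral): a divergent integral takes
   a default value instead of being undefined. *)

Section special_functions.
Context {R : realType}.
Implicit Types s t x : R.

(* Used for s > 0 only. *)
Definition Gamma s : R :=
  \int[lebesgue_measure]_(t in `]0, +oo[) (t `^ (s - 1) * expR (- t)).

(* Used for x > 0 only. *)
Definition E1 x : R :=
  \int[lebesgue_measure]_(t in `[x, +oo[) (expR (- t) / t).

(* Used for t > 0 only. *)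
Definition Skernel t : R :=
  expR (- t) * \int[lebesgue_measure]_(s in `]0, +oo[) (t `^ (s - 1) / Gamma s).

End special_functions.

Section fractional_operators.
Context {R : realType}.
Implicit Types (a b alpha x : R) (f g F : R -> R).

(* The integration domain is `[a, x[ because the kernels are only meaningful
   on positive reals; this changes nothing up to a null set. *)
Definition Jop a alpha f x : R :=
  alpha^-1 *
  \int[lebesgue_measure]_(t in `[a, x[) (E1 ((x - t) / alpha) * f t).

Definition Sop a alpha f x : R :=
  \int[lebesgue_measure]_(t in `[a, x[) (Skernel ((x - t) / alpha) * f t).

Definition abs_continuous a b F : Prop :=
  forall e : R, 0 < e -> exists2 d : R, 0 < d &
    forall (n : nat) (u v : 'I_n -> R),
      (forall i, [/\ a <= u i, u i <= v i & v i <= b]) ->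
      trivIset [set: 'I_n] (fun i => `]u i, v i[%classic) ->
      \sum_(i < n) (v i - u i) < d ->
      \sum_(i < n) `|F (v i) - F (u i)| < e.

Definition is_ac_repr a b g F : Prop :=
  abs_continuous a b F /\
  {ae lebesgue_measure, forall x, x \in `[a, b] -> F x = g x}.

Definition has_ac_repr a b g : Prop := exists F, is_ac_repr a b g F.

(* Two absolutely continuous representatives of g agree on [a, b], so the
   choice made here only matters outside of [a, b]. *)
Definition ac_repr a b g : R -> R := xget g [set F | is_ac_repr a b g F].

(* Meaningful at the points of ]a, b[ where the representative is
   differentiable, hence almost everywhere on [a, b]. *)
Definition frac_derivative a b alpha f : R -> R :=
  derive1 (ac_repr a b (Jop a alpha f)).

End fractional_operators.

(* Main.v *)
(* With the Gamma densities
     gamma_s(u) = u^(s-1) e^(-u) / Gamma(s),   u > 0,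
   one has S = int_0^oo gamma_s ds, and they form a convolution semigroup:
   gamma_s * gamma_h = gamma_(s+h) (Beta integral).  Let P_s(t) be the integral
   of gamma_s over ]0, t[ and Q_h = 1 - P_h on ]0, +oo[.  Integrating
   P_s = gamma_s * Q_h + P_(s+h) over s > 0 and cancelling the (finite, by a
   Chernoff bound) integral of P_s over s > h gives
     (S * Q_h)(t) = int_0^h P_s(t) ds.
   As h -> 0, Q_h / h tends to E1 and the right-hand side divided by h tends to
   P_0+(t) = 1, hence E1 * S = 1 on ]0, +oo[.  By Fubini J (S f) is then the
   primitive of f, and the Lebesgue differentiation theorem concludes. *)

Require Import Defs.
From HB Require Import structures.
From mathcomp Require Import all_boot all_order all_algebra.
From mathcomp Require Import all_classical all_reals all_analysis.
From mathcomp Require Import measurable_realfun ring lra.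

Set Implicit Arguments.
Unset Strict Implicit.
Unset Printing Implicit Defensive.
Import Order.TTheory GRing.Theory Num.Theory.
Import numFieldNormedType.Exports.
Local Open Scope classical_set_scope.
Local Open Scope ring_scope.

(** * Affine substitution and convolution of nonnegative functions *)

(** The obstacle is that finiteness of Gamma, of S and of E1 * S is not known beforehand, while the
    real-valued integrals take default values. All kernels are therefore nonnegative extended-real
    functions on the whole line, zero on the nonpositive half-line: Tonelli and associativity of
    convolution then hold unconditionally, and finiteness is proved where something is subtracted or
    a real value is read off. The limit h -> 0 is taken by inequalities. As h Gamma(h) = Gamma(h +
    1) tends to 1, dividing Q_h by h amounts to multiplying it by Gamma(h), which gives the upper
    incomplete Gamma function Gamma(h, y); this still makes sense at h = 0, where it is E1(y). Then
    y^h E1(y) <= Gamma(h, y) yields E1 * S <= 1 by monotone convergence, and Gamma(h, y) <= E1(y) +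
    h yields E1 * S >= 1 - O(h), the error being controlled by the finite integral of S over ]0, t[.
    The rate at which Gamma(h + 1) tends to 1 comes from pointwise inequalities between powers. *)

Section lebesgue_substitution.
Context {R : realType}.
Local Notation mu := (@lebesgue_measure R).
Local Open Scope ereal_scope.

(** The image of [mu] under [phi], scaled by [r], gives half-open intervals their length, so it is
    [mu] by uniqueness of Lebesgue measure. *)
Lemma ge0_integral_affine (r c : R) (f : R -> \bar R) : (0 < r)%R ->
  measurable_fun [set: R] f -> (forall x, 0 <= f x) ->
  \int[mu]_x f x = r%:E * \int[mu]_x f (r * x + c)%R.
Proof.
move=> r0 mf f0.
pose phi (x : measurableTypeR R) : measurableTypeR R := (r * x + c)%R.
have mphi : measurable_fun [set: R] phi.
  by apply: measurable_funD => //; exact: measurable_funM.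
pose r' : {nonneg R} := NngNum (ltW r0).
have E A : measurable A -> mu A = mscale r' (pushforward mu phi) A.
  apply: lebesgue_measure_unique => _ [[a b]] _ <-.
  change (mu `]a, b]%classic = r%:E * mu (phi @^-1` `]a, b]%classic)).
  have -> : phi @^-1` `]a, b]%classic = `]((a - c) / r)%R, ((b - c) / r)%R]%classic.
    apply/seteqP; split => x /=; rewrite !in_itv/= /phi ltr_pdivrMr// ler_pdivlMr//;
      by rewrite ltrBlDr lerBrDr (mulrC x).
  rewrite /r' !lebesgue_measure_itv/= !lte_fin ltr_pM2r ?invr_gt0//.
  rewrite ltrD2r; case: ifPn => ab; last by rewrite mule0.
  by rewrite -!EFinB -EFinM; congr EFin; field; rewrite gt_eqF.
rewrite (@eq_measure_integral _ _ _ setT (mscale r' (pushforward mu phi))); last first.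
  by move=> A mA _; exact: E.
rewrite ge0_integral_mscale//=; congr (_ * _).
by rewrite ge0_integral_pushforward//=; move=> ? _; exact: f0.
Qed.

Lemma ge0_integral_translate (c : R) (f : R -> \bar R) :
  measurable_fun [set: R] f -> (forall x, 0 <= f x) ->
  \int[mu]_x f (x + c)%R = \int[mu]_x f x.
Proof.
move=> mf f0; rewrite [RHS](@ge0_integral_affine 1 c)// mul1e.
by apply: eq_integral => x _; rewrite mul1r.
Qed.

(** The integral runs over the whole line; for kernels that vanish on x <= 0 it reduces to ]0,
    x[. *)
Definition conv (k l : R -> \bar R) (x : R) : \bar R :=
  \int[mu]_u (k u * l (x - u)%R).

Lemma measurable_conv_integrand (k l : R -> \bar R) :
  measurable_fun [set: R] k -> measurable_fun setT l ->
  measurable_fun [set: R * R] (fun z : R * R => k z.2 * l (z.1 - z.2)%R).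
Proof.
move=> mk ml; apply: emeasurable_funM; first exact: measurableT_comp.
by apply: measurableT_comp => //; exact: measurable_funB.
Qed.

Lemma measurable_reflect (l : R -> \bar R) (x : R) :
  measurable_fun [set: R] l -> measurable_fun setT (fun u : R => l (x - u)%R).
Proof. by move=> ml; apply: measurableT_comp => //; exact: measurable_funB. Qed.

Variables (k l m : R -> \bar R).
Hypotheses (mk : measurable_fun [set: R] k) (k0 : forall x, 0 <= k x).
Hypotheses (ml : measurable_fun [set: R] l) (l0 : forall x, 0 <= l x).
Hypotheses (mm : measurable_fun [set: R] m) (m0 : forall x, 0 <= m x).

Lemma conv_ge0 x : 0 <= conv k l x.
Proof. by apply: integral_ge0 => u _; exact: mule_ge0. Qed.

Lemma measurable_conv : measurable_fun [set: R] (conv k l).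
Proof.
apply: (@measurable_fun_fubini_tonelli_F _ _ _ _ R mu
  (fun z : R * R => k z.2 * l (z.1 - z.2)%R)).
  exact: measurable_conv_integrand.
by move=> z; exact: mule_ge0.
Qed.

Lemma convA x : conv k (conv l m) x = conv (conv k l) m x.
Proof.
rewrite /conv.
pose g (z : R * R) := k z.1 * (l (z.2 - z.1)%R * m (x - z.2)%R).
have mg : measurable_fun [set: R * R] g.
  apply: emeasurable_funM; first exact: measurableT_comp.
  apply: emeasurable_funM; apply: measurableT_comp => //; exact: measurable_funB.
have g0 z : 0 <= g z by rewrite mule_ge0// mule_ge0.
transitivity (\int[mu]_u \int[mu]_v g (u, v)).
  apply: eq_integral => u _; rewrite /g/=.
  rewrite ge0_integralZl//.
  - congr (_ * _); rewrite -[RHS](ge0_integral_translate u).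
    + by apply: eq_integral => v _; rewrite addrK opprD addrA addrAC.
    + apply: emeasurable_funM; apply: measurableT_comp => //; exact: measurable_funB.
    + by move=> v; exact: mule_ge0.
  - apply: emeasurable_funM; apply: measurableT_comp => //; exact: measurable_funB.
  - by move=> v _; exact: mule_ge0.
rewrite (@fubini_tonelli _ _ _ _ R mu mu g)//.
apply: eq_integral => v _; rewrite /g/= -ge0_integralZr//.
- by apply: eq_integral => u _; rewrite muleA.
- by apply: emeasurable_funM => //; exact: measurable_reflect.
- by move=> u _; exact: mule_ge0.
Qed.

End lebesgue_substitution.

(** * Gamma densities *)

Section truncated_powers.
Context {R : realType}.
Local Notation mu := (@lebesgue_measure R).

Lemma integral_powR01 (h : R) : 0 < h ->
  (\int[mu]_(x in `]0%R, 1%R]) (x `^ (h - 1))%:E = (h^-1)%:E)%E.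
Proof.
move=> h0.
(* The power may be singular at 0, so ]0, 1] is exhausted by the intervals [a n, 1]. This choice
   makes (a n)^h equal to e^-(n+1). *)
pose a n : R := expR (- (n.+1%:R / h)).
have a0 n : 0 < a n by exact: expR_gt0.
have a1 n : a n < 1 by rewrite expR_lt1 oppr_lt0 divr_gt0.
pose F n : set R := `[a n, 1]%classic.
have FE : `]0, 1]%classic = \bigcup_n F n.
  apply/seteqP; split => x /=.
    rewrite in_itv/= => /andP[x0 x1].
    exists (Num.truncn `|h * ln x|) => //; rewrite /F/= in_itv/= x1 andbT.
    rewrite /a -[leRHS](lnK (x := x))//; rewrite ler_expR lerNl ler_pdivlMr//.
    rewrite mulrC mulrN; apply: (le_trans (ler_norm _)); rewrite normrN ltW//.
    exact: truncnS_gt.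
  by move=> [n _]; rewrite /F/= !in_itv/= => /andP[/(lt_le_trans (a0 _))-> ->].
have cp n : {within F n, continuous (fun x : R => x `^ (h - 1))}.
  apply: derivable_within_continuous => x; rewrite in_itv/= => /andP[ax _].
  by apply: derivable_powR; rewrite in_itv/= (lt_le_trans (a0 n)).
have intF n : (\int[mu]_(x in F n) (x `^ (h - 1))%:E = (h^-1 - h^-1 * expR (- n.+1%:R))%:E)%E.
  have d (x : R) : 0 < x -> is_derive x 1 (fun x : R => h^-1 * x `^ h) (x `^ (h - 1)).
    move=> x0; have := @is_derive1_powR R h x x0 => d.
    apply: is_derive_eq; rewrite /GRing.scale/= mulrA mulVf ?mul1r ?gt_eqF//.
  rewrite (@continuous_FTC2 _ _ (fun x : R => h^-1 * x `^ h))//.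
  - rewrite powR1 mulr1 -EFinB; congr (_ - _ * _)%:E.
    by rewrite /a -expRM mulNr divfK// gt_eqF.
  - exact: cp.
  - have cF (x : R) : 0 < x -> {for x, continuous (fun x : R => h^-1 * x `^ h)}.
      move=> /d dx; apply: differentiable_continuous.
      by apply/derivable1_diffP; exact: ex_derive.
    split => [x|  |  ].
    + rewrite in_itv/= => /andP[ax _].
      by have := d _ (lt_trans (a0 n) ax) => dx; exact: ex_derive.
    + by apply: cvg_at_right_filter; exact: (cF _ (a0 n)).
    + by apply: cvg_at_left_filter; exact: (cF _ ltr01).
  - move=> x; rewrite in_itv/= => /andP[ax _].
    have dx := d _ (lt_trans (a0 n) ax).
    by rewrite derive1E; exact: derive_val.
have C : (\int[mu]_(x in F n) (x `^ (h - 1))%:E @[n --> \oo] -->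
    \int[mu]_(x in \bigcup_n F n) (x `^ (h - 1))%:E)%E.
  apply: ge0_nondecreasing_set_cvg_integral.
  - move=> m n mn; apply/subsetPset => x; rewrite /F/= !in_itv/= => /andP[+ ->].
    rewrite andbT; apply: le_trans; rewrite ler_expR lerN2 ler_pM2r ?invr_gt0//.
    by rewrite ler_nat.
  - by move=> i; exact: measurable_itv.
  - by move=> i; apply/measurable_EFinP; apply: measurable_funTS; exact: measurable_powR.
  - by move=> i x _; rewrite lee_fin powR_ge0.
have C' : ((h^-1 - h^-1 * expR (- n.+1%:R))%:E @[n --> \oo] --> (h^-1)%:E)%E.
  apply: cvg_EFin; first by near=> n.
  rewrite -[X in _ --> X]subr0 -(mulr0 h^-1).
  apply: cvgB; first exact: cvg_cst.
  apply: cvgM; first exact: cvg_cst.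
  by rewrite (@cvg_shiftS _ (fun n => expR (- n%:R))); exact: cvgn_expR.
rewrite FE; apply: (cvg_unique (@ereal_hausdorff R) C).
by rewrite (_ : (fun n => _) = fun n => (h^-1 - h^-1 * expR (- n.+1%:R))%:E)//; apply/funext.
Unshelve. all: by end_near. Qed.
End truncated_powers.

Section gamma_kernels.
Context {R : realType}.
Local Notation mu := (@lebesgue_measure R).
Local Open Scope ereal_scope.

(** Domains become pointwise boolean conditions, so that integrals over different domains can be
    added and compared on the whole line. *)
Lemma integral_mkif (D : set R) (p : pred R) (f : R -> \bar R) :
  D = [set x | p x] ->
  \int[mu]_(x in D) f x = \int[mu]_x (if p x then f x else 0).
Proof.
move=> ->; rewrite integral_mkcond; apply: eq_integral => x _.
by rewrite patchE (_ : (x \in [set x | p x]) = p x)//; apply/idP/idP; rewrite inE.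
Qed.

Lemma integral_conv (k l : R -> \bar R) :
  measurable_fun [set: R] k -> (forall x, 0 <= k x) ->
  measurable_fun [set: R] l -> (forall x, 0 <= l x) ->
  \int[mu]_x conv k l x = \int[mu]_x k x * \int[mu]_x l x.
Proof.
move=> mk k0 ml l0; rewrite /conv.
rewrite (@fubini_tonelli _ _ _ _ R mu mu
  (fun z : R * R => k z.2 * l (z.1 - z.2)%R))//; last 2 first.
- exact: measurable_conv_integrand.
- by move=> z; exact: mule_ge0.
transitivity (\int[mu]_u (k u * \int[mu]_x l x)); last first.
  by rewrite ge0_integralZr// integral_ge0.
apply: eq_integral => u _ /=; rewrite ge0_integralZl//.
- by congr (_ * _); exact: (@ge0_integral_translate _ (- u)%R).
- by apply: measurableT_comp => //; exact: measurable_funB.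
Qed.

Definition tpow (s x : R) : R := if (0 < x)%R then (x `^ (s - 1))%R else 0%R.

(** The order is left unrestricted: [gam 0] is the integrand of [E1]. *)
Definition gam (s x : R) : R := (tpow s x * expR (- x))%R.

Lemma tpow_ge0 s x : (0 <= tpow s x)%R.
Proof. by rewrite /tpow; case: ifP => // _; exact: powR_ge0. Qed.

Lemma gam_ge0 s x : (0 <= gam s x)%R.
Proof. by rewrite mulr_ge0 ?tpow_ge0 ?expR_ge0. Qed.

(** Tonelli in the order [s] requires joint measurability, which is visible on exp((s - 1) ln x). *)
Lemma measurable_tpow2 : measurable_fun [set: R * R] (fun z : R * R => tpow z.1 z.2).
Proof.
rewrite (_ : (fun z => _) = fun z : R * R =>
    if (0 < z.2)%R then expR ((z.1 - 1) * ln z.2) else 0%R).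
  apply: measurable_fun_ifT => //; first exact: measurable_fun_ltr.
  apply: measurableT_comp => //; apply: measurable_funM.
    exact: measurable_funB.
  exact: measurableT_comp.
apply/funext => -[s x] /=; rewrite /tpow; case: ifPn => // x0.
by rewrite /powR gt_eqF.
Qed.

Lemma measurable_gam2 : measurable_fun [set: R * R] (fun z : R * R => gam z.1 z.2).
Proof.
apply: measurable_funM; first exact: measurable_tpow2.
by apply: measurableT_comp => //; exact: measurableT_comp.
Qed.

Lemma measurable_tpow s : measurable_fun [set: R] (tpow s).
Proof. exact: (measurableT_comp measurable_tpow2 (measurable_pair1 s)). Qed.

Lemma measurable_gam s : measurable_fun [set: R] (gam s).
Proof. exact: (measurableT_comp measurable_gam2 (measurable_pair1 s)). Qed.

Lemma measurable_etpow s : measurable_fun [set: R] (EFin \o tpow s).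
Proof. by apply/measurable_EFinP; exact: measurable_tpow. Qed.

Lemma measurable_egam s : measurable_fun [set: R] (EFin \o gam s).
Proof. by apply/measurable_EFinP; exact: measurable_gam. Qed.

Lemma etpow_ge0 s x : 0 <= (EFin \o tpow s) x.
Proof. by rewrite lee_fin tpow_ge0. Qed.

Lemma egam_ge0 s x : 0 <= (EFin \o gam s) x.
Proof. by rewrite lee_fin gam_ge0. Qed.

Definition Gam (s : R) : \bar R := \int[mu]_x (gam s x)%:E.
(** The Beta function, as the integral of u^(s-1) (1-u)^(h-1) over ]0, 1[, possibly infinite. *)
Definition betaf (s h : R) : \bar R := conv (EFin \o tpow s) (EFin \o tpow h) 1.

Lemma Gamma_Gam s : Gamma s = fine (Gam s).
Proof.
rewrite /Gamma /Rintegral /Gam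
  (@integral_mkif `]0%R, +oo[%classic (fun x => (0 < x)%R)); last first.
  by apply/seteqP; split => x /=; rewrite in_itv/= andbT.
by congr fine; apply: eq_integral => x _; rewrite /gam /tpow; case: ifP; rewrite ?mul0r.
Qed.

(** Homogeneity: the substitution of w u for u pulls out w^(1 + (s-1) + (h-1)). *)
Lemma conv_tpow (s h w : R) : (0 < w)%R ->
  conv (EFin \o tpow s) (EFin \o tpow h) w = (tpow (s + h) w)%:E * betaf s h.
Proof.
move=> w0; rewrite /betaf /conv.
have m x : measurable_fun [set: R] (fun u => (EFin \o tpow s) u * (EFin \o tpow h) (x - u)%R).
  apply: emeasurable_funM; first exact: measurable_etpow.
  by apply: measurable_reflect; exact: measurable_etpow.
have p x u : 0 <= (EFin \o tpow s) u * (EFin \o tpow h) (x - u)%R.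
  by rewrite mule_ge0// etpow_ge0.
rewrite (ge0_integral_affine 0 w0 (m w) (p w)).
have ma : measurable_fun [set: R] (fun x : R => w * x + 0)%R.
  by apply: measurable_funD => //; exact: measurable_funM.
rewrite -(ge0_integralZl mu measurableT (measurableT_comp (m w) ma)); last 2 first.
- by move=> x _; exact: p.
- by rewrite lee_fin ltW.
rewrite -(ge0_integralZl mu measurableT (m 1%R)); last 2 first.
- by move=> x _; exact: p.
- by rewrite lee_fin tpow_ge0.
apply: eq_integral => u _ /=; rewrite addr0 -!EFinM; congr EFin.
have wn0 : (w != 0)%R by rewrite gt_eqF.
rewrite (_ : w - w * u = w * (1 - u))%R; last by ring.
rewrite /tpow !pmulr_rgt0// w0.
case: ifPn => u0; last by rewrite !mul0r !mulr0.
case: ifPn => u1; last by rewrite !mulr0.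
rewrite !powRM ?ltW//.
rewrite (_ : s + h - 1 = 1 + (s - 1) + (h - 1))%R; last by ring.
rewrite [(w `^ (1 + _ + _))%R]powRD ?wn0 ?implybT// [(w `^ (1 + _))%R]powRD ?wn0 ?implybT//.
by rewrite powRr1 ?ltW//; ring.
Qed.

(** The product of e^-u and e^-(w-u) is e^-w, which leaves the integral and reduces the claim to
    [conv_tpow]. *)
Lemma conv_gam s h : conv (EFin \o gam s) (EFin \o gam h) =
  (fun w => betaf s h * (gam (s + h) w)%:E).
Proof.
apply/funext => w; have [w0|w0] := ltP 0%R w.
  rewrite /gam EFinM muleA [betaf _ _ * _]muleC -conv_tpow// /conv.
  rewrite -ge0_integralZr ?lee_fin ?expR_ge0//; last 2 first.
  - apply: emeasurable_funM; first exact: measurable_etpow.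
    by apply: measurable_reflect; exact: measurable_etpow.
  - by move=> u _; rewrite mule_ge0 ?etpow_ge0.
  apply: eq_integral => u _ /=; rewrite -!EFinM; congr EFin.
  have -> : (expR (- w) = expR (- u) * expR (- (w - u)))%R.
    by rewrite -expRD; congr expR; ring.
  by ring.
rewrite /gam /tpow ltNge w0/= mul0r mule0; apply: integral0_eq => u _ /=.
rewrite -EFinM; case: ifPn => u0; last by rewrite !mul0r.
by rewrite ifF ?mul0r ?mulr0//; apply/negbTE; rewrite -leNgt; lra.
Qed.

Lemma betaf_ge0 s h : 0 <= betaf s h.
Proof. by apply: conv_ge0 => ?; exact: etpow_ge0. Qed.

(** Total masses of the two sides of [conv_gam]. As an identity in the extended reals it also
    transports finiteness, which is how [Gam_lty] uses it. *)
Lemma GamM s h : Gam s * Gam h = betaf s h * Gam (s + h).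
Proof.
rewrite /Gam -[LHS](@integral_conv (EFin \o gam s) (EFin \o gam h)).
- rewrite conv_gam ge0_integralZl//.
  + exact: measurable_egam.
  + by move=> *; exact: egam_ge0.
  + exact: betaf_ge0.
- exact: measurable_egam.
- exact: egam_ge0.
- exact: measurable_egam.
- exact: egam_ge0.
Qed.

Lemma betaf1 (h : R) : (0 < h)%R -> betaf h 1 = (h^-1)%:E.
Proof.
move=> h0; rewrite -(integral_powR01 h0) -integral_itv_bndo_bndc; last first.
  by apply/measurable_EFinP; apply: measurable_funTS; exact: measurable_powR.
rewrite /betaf /conv
  (@integral_mkif `]0%R, 1%R[%classic (fun x => (0 < x) && (x < 1))%R); last first.
  by apply/seteqP; split => x /=; rewrite in_itv/=.
apply: eq_integral => x _ /=; rewrite /tpow -EFinM subr_gt0.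
case: ifPn => //= _; last by rewrite mul0r.
by case: ifPn => _; [rewrite subrr powRr0 mulr1|rewrite mulr0].
Qed.

Lemma integral_expRNy : \int[mu]_(x in `[0%R, +oo[) (expR (- x))%:E = 1.
Proof.
have := @integral_exponential_pdf R 1 ltr01.
rewrite /exponential_pdf => <-; rewrite integral_mkcond.
apply: eq_integral => x _; rewrite !patchE; case: ifP => // _.
by rewrite mul1r mulN1r.
Qed.

Lemma Gam1 : Gam 1 = 1.
Proof.
rewrite -integral_expRNy -integral_itv_obnd_cbnd; last first.
  by apply/measurable_EFinP; apply: measurable_funTS; exact: measurableT_comp.
rewrite (@integral_mkif `]0%R, +oo[%classic (fun x => (0 < x)%R)); last first.
  by apply/seteqP; split => x /=; rewrite in_itv/= andbT.
apply: eq_integral => x _; rewrite /gam /tpow; case: ifPn => //; last by rewrite mul0r.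
by rewrite subrr powRr0 mul1r.
Qed.

End gamma_kernels.

(** * Positivity, finiteness and functional equation of the Gamma function *)

Section gamma_bounds.
Context {R : realType}.
Local Notation mu := (@lebesgue_measure R).
Local Open Scope ereal_scope.

(** Only [1, 2] is kept, where 0 <= ln x <= 1 and e^-x >= e^-2. Besides positivity, this bounds 1 /
    Gamma(s) uniformly for s in ]0, 1]. *)
Lemma Gam_ge (s : R) : (expR (- `|s - 1| - 2))%:E <= Gam s.
Proof.
pose m : R := (expR (- `|s - 1| - 2))%R.
have m0 : (0 < m)%R by exact: expR_gt0.
apply: (@le_trans _ _ (m%:E * mu `[1%R, 2%R])).
  by rewrite lebesgue_measure_itv/= lte_fin ltr1n -EFinB -EFinM lee_fin /m; lra.
rewrite -(integral_cst mu)//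
  (@integral_mkif _ `[1%R, 2%R]%classic (fun x => (1 <= x) && (x <= 2))%R); last first.
  by apply/seteqP; split => x /=; rewrite in_itv/=.
apply: ge0_le_integral => //.
- by move=> x _; case: ifP => // _; rewrite lee_fin ltW.
- have mp : measurable_fun [set: R] (fun x : R => (1 <= x) && (x <= 2))%R.
    by apply: measurable_and; exact: measurable_fun_ler.
  exact: (measurable_fun_ifT mp (measurable_cst m%:E) (measurable_cst 0)).
- exact: measurable_egam.
move=> x _; case: ifPn => [/andP[x1 x2]|_]; last exact: egam_ge0.
rewrite lee_fin /gam /tpow (lt_le_trans ltr01)// /powR gt_eqF ?(lt_le_trans ltr01)//.
rewrite -expRD ler_expR lerB//.
have lnx : (0 <= ln x <= 1)%R.
  rewrite ln_ge0//= -[X in (ln X)](subrKC 1).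
  by apply: (le_trans (le_ln1Dx _)); lra.
have := ler_norm (- (s - 1))%R; rewrite normrN.
have := normr_ge0 (s - 1)%R; move: (`|_|%R) => A A0 As.
by nra.
Qed.

Lemma Gam_gt0 (s : R) : 0 < Gam s.
Proof. by apply: lt_le_trans (Gam_ge s); rewrite lte_fin expR_gt0. Qed.

(** If [q] were infinite, [p * q] would be 0 or +oo, whereas [g * g] is positive and finite. *)
Lemma mule_eq_lty (g p q : \bar R) :
  0 < g -> g < +oo -> 0 <= p -> g * g = p * q -> q < +oo.
Proof.
case: g => [g| |]// + _; rewrite lte_fin => g0.
case: q => [q| |]// + + ; first by rewrite ltry.
rewrite le_eqVlt => /predU1P[<-|p0]; last by rewrite gt0_muley.
by rewrite mul0e -EFinM => -[/eqP]; rewrite gt_eqF// mulr_gt0.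
Qed.

(** For orders at most 1 the integrand is below x^(r-1) on ]0, 1] and below e^-x beyond. Larger
    orders are halved: Gamma(r/2)^2 = B(r/2, r/2) Gamma(r) makes Gamma(r) finite as soon as
    Gamma(r/2) is. *)
Lemma Gam_lty (s : R) : (0 < s)%R -> Gam s < +oo.
Proof.
have small (r : R) : (0 < r <= 1)%R -> Gam r < +oo.
  move=> /andP[r0 r1].
  pose p (x : R) := (0 < x <= 1)%R.
  have mp : measurable_fun [set: R] p.
    by apply: measurable_and; [exact: measurable_fun_ltr|exact: measurable_fun_ler].
  pose f x : \bar R := if p x then (x `^ (r - 1))%:E else 0.
  have mf : measurable_fun [set: R] f.
    apply: measurable_fun_ifT => //; apply/measurable_EFinP; exact: measurable_powR.
  have f0 x : 0 <= f x by rewrite /f; case: ifP => // _; rewrite lee_fin powR_ge0.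
  apply: (@le_lt_trans _ _ (\int[mu]_x (f x + (gam 1 x)%:E))).
    apply: ge0_le_integral => //.
    - by move=> x _; exact: egam_ge0.
    - exact: measurable_egam.
    - by apply: emeasurable_funD => //; exact: measurable_egam.
    move=> x _; rewrite /f /p /gam /tpow; case: ifPn => [x0|]/=; last by rewrite mul0r adde0.
    rewrite subrr powRr0 mul1r; case: ifPn => [x1|].
      rewrite lee_fin -[leLHS]addr0 lerD ?expR_ge0// ger_pMr ?powR_gt0//.
      by rewrite expR_le1 lerNl oppr0 ltW.
    rewrite -ltNge => x1; rewrite add0e lee_fin ger_pMl ?expR_gt0//.
    by rewrite -[leRHS](powRr0 x) ler_powR ?(ltW x1)//; lra.
  rewrite ge0_integralD//; last 2 first.
  - by move=> x _; exact: egam_ge0.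
  - exact: measurable_egam.
  rewrite -[X in _ + X]/(Gam 1) Gam1 /f.
  rewrite -(@integral_mkif _ `]0%R, 1%R]%classic p (fun x => (x `^ (r - 1))%:E)); last first.
    by apply/seteqP; split => x /=; rewrite in_itv/=.
  by rewrite integral_powR01// ltry.
suff H n (r : R) : (0 < r <= n.+1%:R)%R -> Gam r < +oo.
  by move=> s0; apply: (H (Num.truncn s)); rewrite s0 ltW// truncnS_gt.
elim: n r => [|n IH] r /andP[r0 rn]; first by apply: small; rewrite r0.
have [r1|r1] := leP r 1%R; first by apply: small; rewrite r0.
have h : Gam (r / 2) < +oo.
  apply: IH; rewrite divr_gt0//= ler_pdivrMr//; apply: (le_trans rn).
  by rewrite -natrM ler_nat muln2 -addnn addSn ltnS leq_addl.
have := GamM (r / 2) (r / 2); rewrite -splitr.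
exact: mule_eq_lty (Gam_gt0 _) h (betaf_ge0 _ _).
Qed.

Lemma GamE (s : R) : (0 < s)%R -> Gam s = (Gamma s)%:E.
Proof.
by move=> s0; rewrite Gamma_Gam fineK// ge0_fin_numE ?Gam_lty// ltW// Gam_gt0.
Qed.

Lemma Gamma_gt0 (s : R) : (0 < s)%R -> (0 < Gamma s)%R.
Proof. by move=> s0; rewrite -lte_fin -GamE// Gam_gt0. Qed.

Lemma Gamma1 : Gamma 1 = 1%R :> R.
Proof. by rewrite Gamma_Gam Gam1. Qed.

(** This is [GamM] with second order 1, since B(h, 1) = 1/h; it replaces integration by parts. *)
Lemma Gammaj1 (h : R) : (0 < h)%R -> Gamma (h + 1) = (h * Gamma h)%R.
Proof.
move=> h0; have := GamM h 1; rewrite Gam1 mule1 betaf1// !GamE ?addr_gt0//.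
by rewrite -EFinM => -[->]; rewrite mulrA mulfV ?mul1r ?gt_eqF.
Qed.

Lemma betafE (s h : R) : (0 < s)%R -> (0 < h)%R ->
  betaf s h = (Gamma s * Gamma h / Gamma (s + h))%:E.
Proof.
move=> s0 h0; have sh0 : (0 < s + h)%R by rewrite addr_gt0.
rewrite EFinM EFinM -(GamE s0) -(GamE h0) GamM (GamE sh0) -muleA -EFinM mulfV ?mule1//.
by rewrite gt_eqF// Gamma_gt0.
Qed.

End gamma_bounds.

(** * Power inequalities, Gamma near 1, and tails of densities *)

Section resolvent_family.
Context {R : realType}.
Local Notation mu := (@lebesgue_measure R).

(** Weighted arithmetic-geometric inequality for 1 and x, derived from 1 + y <= e^y used at two
    points. *)
Lemma powR_le_onem (h x : R) : 0 <= h <= 1 -> 0 < x -> x `^ h <= 1 - h + h * x.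
Proof.
move=> /andP[h0 h1] x0; rewrite /powR gt_eqF//; set L := ln x.
have -> : x = expR L by rewrite /L lnK.
have w0 := expR_gt0 (h * L).
have A := expR_ge1Dx (- (h * L)).
have B := expR_ge1Dx ((1 - h) * L).
have A' : (1 - h * L) * expR (h * L) <= 1.
  by rewrite -[leRHS](expRxMexpNx_1 (h * L)) mulrC ler_pM2l.
have B' : (1 + (1 - h) * L) * expR (h * L) <= expR L.
  by rewrite -[X in _ <= expR X](_ : (1 - h) * L + h * L = L); [rewrite expRD ler_pM2r|ring].
(* With the weights 1 - h and h the terms in [L] cancel. *)
have : (1 - h) * ((1 - h * L) * expR (h * L)) + h * ((1 + (1 - h) * L) * expR (h * L))
   <= (1 - h) * 1 + h * expR L.
  by rewrite lerD// ler_wpM2l// subr_ge0.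
by rewrite mulr1; apply: le_trans; rewrite le_eqVlt; apply/orP; left; apply/eqP; ring.
Qed.

(** Here x^h >= 1 + h ln x and x^(-1/2) >= 1 - (ln x)/2; the factor 2h makes the logarithms cancel.
    The exponent -1/2 is integrable at 0, so the error integrates to a multiple of Gamma(1/2). *)
Lemma powR_ge_onem (h x : R) : 0 <= h -> 0 < x ->
  1 <= x `^ h + 2 * h * x `^ (2^-1 - 1).
Proof.
move=> h0 x0; rewrite /powR gt_eqF//; set L := ln x.
have A := expR_ge1Dx (h * L).
have B := expR_ge1Dx ((2^-1 - 1) * L).
have := ler_wpM2l (mulr_ge0 (ler0n R 2) h0) B.
move: A; move: (expR _) (expR _) => a b; lra.
Qed.

Local Open Scope ereal_scope.

(** Integrating [powR_le_onem] against e^-x bounds Gamma(h + 1) by (1 - h) Gamma(1) + h Gamma(2) =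
    1. *)
Lemma Gammaj1_le1 (h : R) : (0 < h <= 1)%R -> (Gamma (h + 1) <= 1)%R.
Proof.
move=> /andP[h0 h1]; rewrite -lee_fin -GamE ?addr_gt0//.
have G2 : Gam 2 = 1 :> \bar R.
  by rewrite (_ : 2 = 1 + 1)%R// GamE// Gammaj1// mul1r Gamma1.
have <- : (1 - h)%:E * Gam 1 + h%:E * Gam 2 = 1.
  by rewrite G2 Gam1 !mule1 -EFinD subrK.
rewrite -!ge0_integralZl ?lee_fin ?(ltW h0) ?subr_ge0//.
- rewrite -ge0_integralD//.
  + apply: ge0_le_integral => //.
    * by move=> x _; exact: egam_ge0.
    * exact: measurable_egam.
    * by apply: emeasurable_funD; apply: measurable_funeM; exact: measurable_egam.
    move=> x _; rewrite -!EFinM -EFinD lee_fin /gam !mulrA -mulrDl.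
    rewrite ler_wpM2r ?expR_ge0// /tpow; case: ifPn => x0; last by rewrite !mulr0 addr0.
    rewrite addrK subrr powRr0 mulr1 (_ : 2 - 1 = 1)%R; last by ring.
    by rewrite powRr1 ?(ltW x0)// powR_le_onem// (ltW h0).
  + by move=> x _; rewrite -EFinM lee_fin mulr_ge0 ?gam_ge0 ?subr_ge0.
  + by apply: measurable_funeM; exact: measurable_egam.
  + by move=> x _; rewrite -EFinM lee_fin mulr_ge0 ?gam_ge0 ?(ltW h0).
  + by apply: measurable_funeM; exact: measurable_egam.
- exact: measurable_egam.
- by move=> x _; exact: egam_ge0.
- exact: measurable_egam.
- by move=> x _; exact: egam_ge0.
Qed.

(** [powR_ge_onem] integrated against e^-x: a quantitative lower bound for h Gamma(h) as h -> 0. *)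
Lemma Gammaj1_ge (h : R) : (0 < h)%R -> (1 <= Gamma (h + 1) + 2 * h * Gamma (2^-1))%R.
Proof.
move=> h0; rewrite -lee_fin EFinD EFinM -!GamE ?addr_gt0 ?invr_gt0//.
rewrite -Gam1 -ge0_integralZl ?lee_fin ?mulr_ge0 ?(ltW h0)//.
- rewrite -ge0_integralD//.
  + apply: ge0_le_integral => //.
    * by move=> x _; exact: egam_ge0.
    * exact: measurable_egam.
    * by apply: emeasurable_funD; [|apply: measurable_funeM]; exact: measurable_egam.
    move=> x _; rewrite -!EFinM -EFinD lee_fin /gam !mulrA -mulrDl.
    rewrite ler_wpM2r ?expR_ge0// /tpow; case: ifPn => x0; last by rewrite !mulr0 addr0.
    by rewrite addrK subrr powRr0 powR_ge_onem// ltW.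
  + by move=> x _; exact: egam_ge0.
  + exact: measurable_egam.
  + by move=> x _; rewrite -EFinM lee_fin mulr_ge0 ?gam_ge0 ?mulr_ge0 ?(ltW h0).
  + by apply: measurable_funeM; exact: measurable_egam.
- exact: measurable_egam.
- by move=> x _; exact: egam_ge0.
Qed.

(** Convolution with this Heaviside function is integration up to t: [conv (gpdf s) hstep] is P_s of
    the overview, and [tail (gpdf h)] is Q_h. *)
Definition hstep (x : R) : \bar R := if (0 < x)%R then 1 else 0.

Definition tail (k : R -> \bar R) (y : R) : \bar R :=
  if (0 < y)%R then \int[mu]_v (if (y <= v)%R then k v else 0) else 0.

Lemma hstep_ge0 x : 0 <= hstep x.
Proof. by rewrite /hstep; case: ifP. Qed.

Lemma measurable_hstep : measurable_fun [set: R] hstep.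
Proof. by apply: measurable_fun_ifT => //; exact: measurable_fun_ltr. Qed.

Lemma tail_ge0 k y : (forall x, 0 <= k x) -> 0 <= tail k y.
Proof.
by move=> k0; rewrite /tail; case: ifP => // _; apply: integral_ge0 => v _; case: ifP.
Qed.

Lemma measurable_tail_integrand (k : R -> \bar R) (y : R) : measurable_fun [set: R] k ->
  measurable_fun [set: R] (fun v : R => if (y <= v)%R then k v else 0).
Proof. by move=> mk; apply: measurable_fun_ifT => //; exact: measurable_fun_ler. Qed.

Lemma measurable_tail (k : R -> \bar R) : measurable_fun [set: R] k -> (forall x, 0 <= k x) ->
  measurable_fun [set: R] (tail k).
Proof.
move=> mk k0; apply: measurable_fun_ifT => //; first exact: measurable_fun_ltr.
apply: (@measurable_fun_fubini_tonelli_F _ _ _ _ R mu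
  (fun z : R * R => if (z.1 <= z.2)%R then k z.2 else 0)).
  apply: measurable_fun_ifT => //; first exact: measurable_fun_ler.
  exact: measurableT_comp.
by move=> z; case: ifP.
Qed.

(** For y > 0 the unit mass of [k] is split at y; for y <= 0 everything vanishes because [k] lives
    on the positive half-line. *)
Lemma hstepE (k : R -> \bar R) (y : R) : measurable_fun [set: R] k -> (forall x, 0 <= k x) ->
  (forall x, (x <= 0)%R -> k x = 0) -> \int[mu]_x k x = 1 ->
  hstep y = conv k hstep y + tail k y.
Proof.
move=> mk k0 kn k1; rewrite /conv /tail {1}/hstep; case: ifPn => y0; last first.
  rewrite adde0; apply/esym/integral0_eq => u _; have [u0|u0] := leP u 0%R.
    by rewrite kn// mul0e.
  rewrite /hstep ifF ?mule0//; apply/negbTE; move: y0; rewrite -!leNgt; lra.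
rewrite -k1 -ge0_integralD//; last 4 first.
- by move=> u _; rewrite mule_ge0// hstep_ge0.
- by apply: emeasurable_funM => //; apply: measurable_reflect; exact: measurable_hstep.
- by move=> u _; case: ifP.
- exact: measurable_tail_integrand.
apply: eq_integral => u _; rewrite /hstep subr_gt0.
by case: ltP => _; rewrite ?mule1 ?adde0// mule0 add0e.
Qed.

End resolvent_family.

(** * The convolution semigroup of normalised Gamma densities *)

Section gamma_semigroup.
Context {R : realType}.
Local Notation mu := (@lebesgue_measure R).
Local Open Scope ereal_scope.

(** The value 0 for s <= 0 lets the order be integrated over the whole line. *)
Definition gpdf (s x : R) : \bar R :=
  if (0 < s)%R then (gam s x / Gamma s)%:E else 0.

Lemma gpdf_ge0 (s x : R) : 0 <= gpdf s x.
Proof.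
rewrite /gpdf; case: ifPn => // s0.
by rewrite lee_fin divr_ge0 ?gam_ge0// ltW// Gamma_gt0.
Qed.

Lemma gpdf_le0 (s x : R) : (x <= 0)%R -> gpdf s x = 0.
Proof. by move=> x0; rewrite /gpdf /gam /tpow (ltNge 0%R x) x0 !mul0r if_same. Qed.

Lemma measurable_Gamma : measurable_fun [set: R] (@Gamma R).
Proof.
rewrite (_ : @Gamma R = fine \o Gam); last by apply/funext => s; rewrite Gamma_Gam.
apply: measurableT_comp => //.
apply: (@measurable_fun_fubini_tonelli_F _ _ _ _ R mu (fun z : R * R => (gam z.1 z.2)%:E)).
  by apply/measurable_EFinP; exact: measurable_gam2.
by move=> z; exact: egam_ge0.
Qed.

Lemma measurable_gpdf2 : measurable_fun [set: R * R] (fun z : R * R => gpdf z.1 z.2).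
Proof.
(* For s > 0 the reciprocal of Gamma(s) is exp(-ln Gamma(s)), a composition of measurable
   functions. *)
rewrite (_ : (fun z => _) = fun z : R * R =>
    if (0 < z.1)%R then (gam z.1 z.2 * expR (- ln (Gamma z.1)))%:E else 0); last first.
  apply/funext => -[s x]/=; rewrite /gpdf; case: ifPn => // s0.
  by rewrite expRN lnK// posrE Gamma_gt0.
apply: measurable_fun_ifT => //; first exact: measurable_fun_ltr.
apply/measurable_EFinP; apply: measurable_funM; first exact: measurable_gam2.
apply: measurableT_comp => //; apply: measurableT_comp => //.
by apply: measurableT_comp => //; apply: measurableT_comp => //; exact: measurable_Gamma.
Qed.

Lemma measurable_gpdf (s : R) : measurable_fun [set: R] (gpdf s).
Proof. exact: (measurableT_comp measurable_gpdf2 (measurable_pair1 s)). Qed.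

Lemma gpdfE (s : R) : (0 < s)%R -> gpdf s = (fun x => ((Gamma s)^-1)%:E * (gam s x)%:E).
Proof. by move=> s0; apply/funext => x; rewrite /gpdf s0 -EFinM mulrC. Qed.

Lemma integral_gpdf (s : R) : (0 < s)%R -> \int[mu]_x gpdf s x = 1.
Proof.
move=> s0; rewrite gpdfE// ge0_integralZl//.
- rewrite -[X in _ * X]/(Gam s) GamE// -EFinM mulVf// gt_eqF// Gamma_gt0//.
- exact: measurable_egam.
- by move=> x _; exact: egam_ge0.
- by rewrite lee_fin invr_ge0 ltW// Gamma_gt0.
Qed.

Lemma conv_gpdf (s h : R) : (0 < s)%R -> (0 < h)%R -> conv (gpdf s) (gpdf h) = gpdf (s + h).
Proof.
move=> s0 h0; have sh0 : (0 < s + h)%R by rewrite addr_gt0.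
have Gs := Gamma_gt0 s0; have Gh := Gamma_gt0 h0; have Gsh := Gamma_gt0 sh0.
apply/funext => x; rewrite (gpdfE sh0).
transitivity (((Gamma s)^-1 * (Gamma h)^-1)%:E * conv (EFin \o gam s) (EFin \o gam h) x).
  rewrite /conv -ge0_integralZl//.
  - apply: eq_integral => u _; rewrite (gpdfE s0) (gpdfE h0) /= -!EFinM.
    by congr EFin; move: (Gamma s) (Gamma h) => p q; ring.
  - apply: emeasurable_funM; first exact: measurable_egam.
    by apply: measurable_reflect; exact: measurable_egam.
  - by move=> u _; rewrite mule_ge0 ?egam_ge0.
  - by rewrite lee_fin mulr_ge0 ?invr_ge0 ?(ltW Gs) ?(ltW Gh).
rewrite conv_gam (betafE s0 h0) -!EFinM; congr EFin.
move: (Gamma s) (Gamma h) (Gamma (s + h)) Gs Gh Gsh => p q r p0 q0 r0.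
by field; rewrite !gt_eqF.
Qed.

Lemma gpdf_cdf_le1 (s t : R) : conv (gpdf s) hstep t <= 1.
Proof.
have [s0|s0] := ltP 0%R s; last first.
  rewrite /conv (_ : (fun u => _) = cst 0) ?integral0//.
  by apply/funext => u; rewrite /gpdf ltNge s0/= mul0e.
rewrite -(integral_gpdf s0); apply: ge0_le_integral => //.
- by move=> u _; rewrite mule_ge0 ?gpdf_ge0 ?hstep_ge0.
- apply: emeasurable_funM; first exact: measurable_gpdf.
  by apply: measurable_reflect; exact: measurable_hstep.
- exact: measurable_gpdf.
move=> u _; rewrite -[leRHS]mule1 lee_wpmul2l ?gpdf_ge0// /hstep.
by case: ifP.
Qed.

(* Chernoff bound with the rate parameter [e], i.e. [expR 1]. *)
Lemma gpdf_cdf_le (s t : R) : (0 < s)%R ->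
  conv (gpdf s) hstep t <= (expR ((expR 1 - 1) * t))%:E * (gam 1 s)%:E.
Proof.
move=> s0; pose e : R := expR 1; pose c : R := (expR ((e - 1) * t))%R.
have e1 : (1 <= e)%R by rewrite /e -(expR0 R) ler_expR.
have Gs := Gamma_gt0 s0.
(* For u < t, 1 <= e^((e-1)(t-u)). Together with e^-u this leaves the rate e, and the integral of
   u^(s-1) e^(-eu) is e^-s Gamma(s): the rate e is chosen so that the decay in s is exactly
   [gam 1 s]. *)
pose f (u : R) := (c * (Gamma s)^-1)%:E * (tpow s u * expR (- (e * u)))%:E.
have mf : measurable_fun [set: R] (fun u : R => (tpow s u * expR (- (e * u)))%:E).
  apply/measurable_EFinP; apply: measurable_funM; first exact: measurable_tpow.
  by apply: measurableT_comp => //; apply: measurableT_comp => //; exact: measurable_funM.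
apply: (@le_trans _ _ (\int[mu]_u f u)).
  apply: ge0_le_integral => //.
  - by move=> u _; rewrite mule_ge0 ?gpdf_ge0 ?hstep_ge0.
  - apply: emeasurable_funM; first exact: measurable_gpdf.
    by apply: measurable_reflect; exact: measurable_hstep.
  - exact: measurable_funeM.
  move=> u _; rewrite /hstep subr_gt0 /f; case: ifPn => ut; last first.
    by rewrite mule0 -EFinM lee_fin !mulr_ge0 ?invr_ge0 ?expR_ge0 ?tpow_ge0 ?ltW.
  rewrite mule1 gpdfE// -!EFinM lee_fin.
  rewrite [leRHS](_ : _ = (Gamma s)^-1 * (c * (tpow s u * expR (- (e * u)))))%R; last by ring.
  rewrite ler_wpM2l ?invr_ge0 ?(ltW Gs)//.
  rewrite /gam mulrCA ler_wpM2l ?tpow_ge0// /c -expRD ler_expR.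
  have : (0 <= (e - 1) * (t - u))%R by rewrite mulr_ge0 ?subr_ge0// ltW.
  lra.
have e0 : (0 < e)%R by exact: expR_gt0.
rewrite ge0_integralZl//; last 2 first.
- by move=> u _; rewrite lee_fin mulr_ge0 ?expR_ge0 ?tpow_ge0.
- by rewrite lee_fin mulr_ge0 ?invr_ge0 ?expR_ge0 ?ltW.
have := GamE s0; rewrite /Gam (@ge0_integral_affine _ e 0)//; last 2 first.
- exact: measurable_egam.
- by move=> x; exact: egam_ge0.
have -> : \int[mu]_u (gam s (e * u + 0))%:E =
    \int[mu]_u ((expR (s - 1))%:E * (tpow s u * expR (- (e * u)))%:E).
  apply: eq_integral => u _; rewrite addr0 -EFinM /gam /tpow pmulr_rgt0//.
  congr EFin; case: ifPn => u0; last by rewrite !mul0r mulr0.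
  by rewrite powRM ?ltW// -mulrA /e -expRM mul1r.
rewrite ge0_integralZl//; last first.
- by move=> u _; rewrite lee_fin mulr_ge0 ?expR_ge0 ?tpow_ge0.
rewrite muleA -EFinM /e -expRD subrKC => E.
suff -> : \int[mu]_u (tpow s u * expR (- (expR 1 * u)))%:E = (expR (- s) * Gamma s)%:E.
  rewrite -!EFinM lee_fin /c /e /gam /tpow s0 subrr powRr0 mul1r le_eqVlt.
  by apply/orP; left; apply/eqP; field; rewrite gt_eqF.
by rewrite EFinM -E muleA -EFinM -expRD addNr expR0 mul1e.
Qed.

End gamma_semigroup.

(** * The kernel S as an integral of Gamma densities *)

Section resolvent.
Context {R : realType}.
Local Notation mu := (@lebesgue_measure R).
Local Open Scope ereal_scope.

Definition gsum (u : R) : \bar R := \int[mu]_s gpdf s u.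

Lemma gsum_ge0 u : 0 <= gsum u.
Proof. by apply: integral_ge0 => s _; exact: gpdf_ge0. Qed.

Lemma gsum_le0 (u : R) : (u <= 0)%R -> gsum u = 0.
Proof. by move=> u0; apply: integral0_eq => s _; exact: gpdf_le0. Qed.

Lemma measurable_gsum : measurable_fun [set: R] gsum.
Proof.
apply: (@measurable_fun_fubini_tonelli_G _ _ _ _ R mu (fun z : R * R => gpdf z.1 z.2)).
  exact: measurable_gpdf2.
by move=> z; exact: gpdf_ge0.
Qed.

Section conv_gsum.
Variables (l : R -> \bar R) (t : R).
Hypotheses (ml : measurable_fun [set: R] l) (l0 : forall x, 0 <= l x).

Let g (z : R * R) := gpdf z.1 z.2 * l (t - z.2)%R.

Let mg : measurable_fun [set: R * R] g.
Proof.
apply: emeasurable_funM; first exact: measurable_gpdf2.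
by apply: measurableT_comp => //; exact: measurable_funB.
Qed.

Let g0 z : 0 <= g z. Proof. by rewrite mule_ge0 ?gpdf_ge0. Qed.

Lemma conv_gsum : conv gsum l t = \int[mu]_s conv (gpdf s) l t.
Proof.
rewrite /conv (@fubini_tonelli _ _ _ _ R mu mu g)//.
apply: eq_integral => u _; rewrite /g/= ge0_integralZr//.
- exact: (measurableT_comp measurable_gpdf2 (measurable_pair2 u)).
- by move=> s _; exact: gpdf_ge0.
Qed.

Lemma measurable_conv_gpdf : measurable_fun [set: R] (fun s => conv (gpdf s) l t).
Proof. exact: (@measurable_fun_fubini_tonelli_F _ _ _ _ R mu g). Qed.

End conv_gsum.

Lemma conv_gpdf_ge0 (s t : R) : 0 <= conv (gpdf s) hstep t.
Proof. by apply: conv_ge0 => ?; [exact: gpdf_ge0|exact: hstep_ge0]. Qed.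

Lemma conv_gpdf_le0 (s t : R) (l : R -> \bar R) : (s <= 0)%R -> conv (gpdf s) l t = 0.
Proof. by move=> s0; apply: integral0_eq => u _; rewrite /gpdf ltNge s0 mul0e. Qed.

(** The Chernoff bound is integrated over the order, where [gam 1] has mass 1. This finiteness
    permits the cancellation in [conv_gsum_tail_gpdf] and later gives local integrability of S. *)
Lemma conv_gsum_hstep_lty (t : R) : conv gsum hstep t < +oo.
Proof.
rewrite conv_gsum; [|exact: measurable_hstep|exact: hstep_ge0].
apply: (@le_lt_trans _ _ (\int[mu]_s ((expR ((expR 1 - 1) * t))%:E * (gam 1 s)%:E))).
  apply: ge0_le_integral => //.
  - by move=> s _; exact: conv_gpdf_ge0.
  - by apply: measurable_conv_gpdf; [exact: measurable_hstep|exact: hstep_ge0].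
  - by apply: measurable_funeM; exact: measurable_egam.
  move=> s _; have [s0|s0] := ltP 0%R s; first exact: gpdf_cdf_le.
  by rewrite conv_gpdf_le0// mule_ge0 ?lee_fin ?expR_ge0 ?gam_ge0.
rewrite ge0_integralZl ?lee_fin ?expR_ge0//.
- by rewrite -[X in _ * X]/(Gam 1) Gam1 mule1 ltry.
- exact: measurable_egam.
- by move=> x _; exact: egam_ge0.
Qed.

Lemma conv_gsum_tail_gpdf (h t : R) : (0 < h)%R ->
  conv gsum (tail (gpdf h)) t =
  \int[mu]_(s in `]0%R, h]) conv (gpdf s) hstep t.
Proof.
move=> h0.
pose P s := conv (gpdf s) hstep t.
have P0 s : 0 <= P s by exact: conv_gpdf_ge0.
have mP : measurable_fun [set: R] P.
  by apply: measurable_conv_gpdf; [exact: measurable_hstep|exact: hstep_ge0].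
have mcgh : measurable_fun [set: R] (conv (gpdf h) hstep).
  apply: measurable_conv; [exact: measurable_gpdf|exact: gpdf_ge0
    |exact: measurable_hstep|exact: hstep_ge0].
have cgh0 x : 0 <= conv (gpdf h) hstep x by exact: conv_gpdf_ge0.
have mt : measurable_fun [set: R] (tail (gpdf h)).
  by apply: measurable_tail; [exact: measurable_gpdf|exact: gpdf_ge0].
have t0 x : 0 <= tail (gpdf h) x by apply: tail_ge0 => y; exact: gpdf_ge0.
have E1 : conv gsum hstep t =
    conv gsum (conv (gpdf h) hstep) t + conv gsum (tail (gpdf h)) t.
  rewrite /conv -/conv -ge0_integralD//.
  - apply: eq_integral => u _; rewrite (@hstepE _ (gpdf h)).
    + by rewrite ge0_muleDr.
    + exact: measurable_gpdf.
    + exact: gpdf_ge0.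
    + by move=> x; exact: gpdf_le0.
    + exact: integral_gpdf.
  - by move=> u _; exact: mule_ge0 (gsum_ge0 _) (cgh0 _).
  - by apply: emeasurable_funM; [exact: measurable_gsum|exact: (measurable_reflect t mcgh)].
  - by move=> u _; exact: mule_ge0 (gsum_ge0 _) (t0 _).
  - by apply: emeasurable_funM; [exact: measurable_gsum|exact: (measurable_reflect t mt)].
have mPh : measurable_fun [set: R] (fun s => if (h < s)%R then P s else 0).
  by apply: measurable_fun_ifT => //; exact: measurable_fun_ltr.
have Ph0 s : 0 <= (if (h < s)%R then P s else 0) by case: ifP.
have E2 : conv gsum (conv (gpdf h) hstep) t = \int[mu]_s (if (h < s)%R then P s else 0).
  (* By the semigroup law, convolving with [gpdf h] shifts the order by h, so a translation leaves
     the orders s > h. *)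
  rewrite conv_gsum// -[RHS](ge0_integral_translate h)//.
  apply: eq_integral => s _; rewrite ltrDr; case: ifPn => s0; last first.
    by rewrite (@conv_gpdf_le0 s)// leNgt.
  rewrite convA ?conv_gpdf//; by [exact: measurable_gpdf|exact: gpdf_ge0
    |exact: measurable_hstep|exact: hstep_ge0].
have E3 : conv gsum hstep t = \int[mu]_s (if (h < s)%R then P s else 0) +
    \int[mu]_(s in `]0%R, h]) P s.
  rewrite conv_gsum; [|exact: measurable_hstep|exact: hstep_ge0].
  pose p (s : R) := ((0 < s) && (s <= h))%R.
  have mp : measurable_fun [set: R] p.
    by apply: measurable_and; [exact: measurable_fun_ltr|exact: measurable_fun_ler].
  rewrite (@integral_mkif _ `]0%R, h]%classic p); last first.
    by apply/seteqP; split => x /=; rewrite in_itv/=.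
  rewrite -ge0_integralD//.
  - apply: eq_integral => s _; rewrite /p -/(P s).
    have [s0|s0] := ltP 0%R s; last by rewrite /P conv_gpdf_le0// !if_same adde0.
    by case: ltP => _; rewrite ?add0e ?adde0.
  - by move=> s _; case: ifP.
  - exact: measurable_fun_ifT.
have fh : \int[mu]_s (if (h < s)%R then P s else 0) \is a fin_num.
  rewrite ge0_fin_numE ?integral_ge0//; apply: le_lt_trans (conv_gsum_hstep_lty t).
  by rewrite E3 leeDl// integral_ge0.
rewrite -[LHS](addeK _ fh) -[RHS](addeK _ fh); congr (_ - _).
by rewrite addeC -{1}E2 -E1 E3 addeC.
Qed.

End resolvent.

(** * The limit h -> 0 and the identity E1 * S = 1 *)

Section conv_gsum_tail.
Context {R : realType}.
Local Notation mu := (@lebesgue_measure R).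
Local Open Scope ereal_scope.

Lemma cvg_powR_harmonic (x : R) : (0 < x)%R ->
  (x `^ (n.+1%:R^-1))%R @[n --> \oo] --> (1 : R)%R.
Proof.
move=> x0; rewrite (_ : (fun n => _) = fun n => expR (n.+1%:R^-1 * ln x)); last first.
  by apply/funext => n; rewrite /powR gt_eqF.
have c0 : (n.+1%:R^-1 * ln x)%R @[n --> \oo] --> (0 : R)%R.
  by rewrite -[X in _ --> X](mul0r (ln x)); apply: cvgM; [exact: cvg_harmonic|exact: cvg_cst].
by rewrite -[X in _ --> X](expR0 R); apply: continuous_cvg => //; exact: continuous_expR.
Qed.

(** The upper incomplete Gamma function, cut off at y <= 0. Unlike the normalised tail it is
    meaningful at s = 0, where it is [E1]. *)
Definition gtail (s : R) : R -> \bar R := tail (EFin \o gam s).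

Lemma gtail_ge0 (s y : R) : 0 <= gtail s y.
Proof. by apply: tail_ge0 => x; exact: egam_ge0. Qed.

Lemma measurable_gtail (s : R) : measurable_fun [set: R] (gtail s).
Proof. by apply: measurable_tail; [exact: measurable_egam|exact: egam_ge0]. Qed.

Lemma gtail_le0 (s y : R) : (y <= 0)%R -> gtail s y = 0.
Proof. by move=> y0; rewrite /gtail /tail ltNge y0. Qed.

Lemma measurable_gtail_integrand (s y : R) :
  measurable_fun [set: R] (fun v : R => if (y <= v)%R then (gam s v)%:E else 0).
Proof. by apply: measurable_tail_integrand; exact: measurable_egam. Qed.

Lemma gtail_integrand_ge0 (s y v : R) : 0 <= (if (y <= v)%R then (gam s v)%:E else 0).
Proof. by case: ifP => // _; exact: egam_ge0. Qed.

Lemma gtailE (s y : R) : (0 < y)%R ->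
  gtail s y = \int[mu]_v (if (y <= v)%R then (gam s v)%:E else 0).
Proof. by rewrite /gtail /tail => ->. Qed.

Lemma gtail_le_Gam (s y : R) : gtail s y <= Gam s.
Proof.
have [y0|y0] := ltP 0%R y; last by rewrite gtail_le0// integral_ge0// => x _; exact: egam_ge0.
rewrite gtailE//; apply: ge0_le_integral => //.
- by move=> v _; exact: gtail_integrand_ge0.
- exact: measurable_gtail_integrand.
- exact: measurable_egam.
by move=> v _; case: ifP => // _; exact: egam_ge0.
Qed.

Lemma tail_gpdf (h y : R) : (0 < h)%R ->
  tail (gpdf h) y = ((Gamma h)^-1)%:E * gtail h y.
Proof.
move=> h0; have [y0|y0] := ltP 0%R y; last by rewrite gtail_le0// /tail ltNge y0 mule0.
rewrite gtailE// /tail y0 -ge0_integralZl//.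
- by apply: eq_integral => v _; case: ifP => _; rewrite ?mule0// gpdfE.
- exact: measurable_gtail_integrand.
- by move=> v _; exact: gtail_integrand_ge0.
- by rewrite lee_fin invr_ge0 ltW// Gamma_gt0.
Qed.

(** On v >= y one has y^h v^-1 <= v^(h-1). *)
Lemma gtail0_le (h y : R) : (0 <= h)%R -> (0 < y)%R ->
  (y `^ h)%:E * gtail 0 y <= gtail h y.
Proof.
move=> h0 y0; rewrite !gtailE// -ge0_integralZl ?lee_fin ?powR_ge0//; last 2 first.
- exact: measurable_gtail_integrand.
- by move=> v _; exact: gtail_integrand_ge0.
apply: ge0_le_integral => //.
- by move=> v _; rewrite mule_ge0 ?lee_fin ?powR_ge0 ?gtail_integrand_ge0.
- by apply: measurable_funeM; exact: measurable_gtail_integrand.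
- exact: measurable_gtail_integrand.
move=> v _; case: ifPn => yv; last by rewrite mule0.
have v0 : (0 < v)%R by exact: lt_le_trans yv.
have vn0 : (v != 0)%R by rewrite gt_eqF.
rewrite -EFinM lee_fin /gam mulrA ler_wpM2r ?expR_ge0// /tpow v0.
rewrite sub0r powR_inv1 ?(ltW v0)// powRB ?vn0 ?implybT// powRr1 ?(ltW v0)//.
rewrite ler_pM2r ?invr_gt0//.
by rewrite ge0_ler_powR// nnegrE ltW.
Qed.

(** Dividing v^h <= 1 - h + h v by v gives v^(h-1) <= v^-1 + h; the last term contributes at most h
    Gamma(1). *)
Lemma gtail_le (h y : R) : (0 < h <= 1)%R ->
  gtail h y <= gtail 0 y + h%:E * hstep y.
Proof.
move=> /andP[h0 h1]; have [y0|y0] := ltP 0%R y; last first.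
  by rewrite !gtail_le0// add0e mule_ge0 ?lee_fin ?hstep_ge0// ltW.
apply: (@le_trans _ _ (gtail 0 y + h%:E * gtail 1 y)); last first.
  rewrite leeD2l// lee_wpmul2l ?lee_fin ?(ltW h0)// /hstep y0 -(@Gam1 R).
  exact: gtail_le_Gam.
rewrite !gtailE// -ge0_integralZl ?lee_fin ?(ltW h0)//; last 2 first.
- exact: measurable_gtail_integrand.
- by move=> v _; exact: gtail_integrand_ge0.
rewrite -ge0_integralD//; last 4 first.
- by move=> v _; exact: gtail_integrand_ge0.
- exact: measurable_gtail_integrand.
- by move=> v _; rewrite mule_ge0 ?lee_fin ?gtail_integrand_ge0// ltW.
- by apply: measurable_funeM; exact: measurable_gtail_integrand.
apply: ge0_le_integral => //.
- by move=> v _; exact: gtail_integrand_ge0.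
- exact: measurable_gtail_integrand.
- apply: emeasurable_funD; [|apply: measurable_funeM]; exact: measurable_gtail_integrand.
move=> v _; case: ifPn => yv; last by rewrite mule0 adde0.
have v0 : (0 < v)%R by exact: lt_le_trans yv.
have vn0 : (v != 0)%R by rewrite gt_eqF.
rewrite -EFinM -EFinD lee_fin /gam mulrA -mulrDl ler_wpM2r ?expR_ge0// /tpow v0.
rewrite subrr powRr0 mulr1 sub0r powR_inv1 ?(ltW v0)//.
rewrite powRB ?vn0 ?implybT// powRr1 ?(ltW v0)// ler_pdivrMr// mulrDl mulVf ?gt_eqF//.
have hh : (0 <= h <= 1)%R by rewrite ltW.
by have := powR_le_onem hh v0; lra.
Qed.

(** By [gtail0_le] at h = 1, y E1(y) is at most Gamma(1) = 1. *)
Lemma gtail0_lty (y : R) : gtail 0 y < +oo.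
Proof.
have [y0|y0] := ltP 0%R y; last by rewrite gtail_le0.
have : y%:E * gtail 0 y <= 1.
  rewrite -{1}(powRr1 (ltW y0)) -(@Gam1 R).
  by apply: (le_trans (gtail0_le _ _)) => //; exact: gtail_le_Gam.
have := gtail_ge0 0 y; case: (gtail 0 y) => [r| |]//; first by rewrite ltry.
by rewrite gt0_muley.
Qed.

Section fixed_time.
Variable t : R.
Hypothesis t0 : (0 < t)%R.

Let mint l : measurable_fun [set: R] l ->
  measurable_fun [set: R] (fun u : R => gsum u * l (t - u)%R).
Proof.
by move=> ml; apply: emeasurable_funM; [exact: measurable_gsum|exact: measurable_reflect].
Qed.

Let J (h : R) := \int[mu]_(s in `]0%R, h]) conv (gpdf s) hstep t.

Let mP (h : R) : measurable_fun `]0%R, h]%classic (fun s => conv (gpdf s) hstep t).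
Proof.
apply: measurable_funTS; apply: measurable_conv_gpdf;
  [exact: measurable_hstep|exact: hstep_ge0].
Qed.

Let conv_gtail (h : R) : (0 < h)%R -> conv gsum (gtail h) t = (Gamma h)%:E * J h.
Proof.
move=> h0; rewrite /J -conv_gsum_tail_gpdf// /conv -ge0_integralZl//.
- apply: eq_integral => u _; rewrite tail_gpdf// muleCA; congr (_ * _).
  by rewrite muleA -EFinM mulfV ?mul1e// gt_eqF// Gamma_gt0.
- by apply: mint; apply: measurable_tail; [exact: measurable_gpdf|exact: gpdf_ge0].
- by move=> u _; rewrite mule_ge0 ?gsum_ge0// tail_ge0// => x; exact: gpdf_ge0.
- by rewrite lee_fin ltW// Gamma_gt0.
Qed.

Let J_le (h : R) : (0 < h)%R -> J h <= h%:E.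
Proof.
move=> h0; rewrite -[leRHS]mul1e (_ : h%:E = mu `]0%R, h]); last first.
  by rewrite lebesgue_measure_itv/= lte_fin h0 -EFinB subr0.
rewrite -integral_cst//; apply: ge0_le_integral => //.
- by move=> s _; exact: conv_gpdf_ge0.
- exact: mP.
- by move=> s _; exact: gpdf_cdf_le1.
Qed.

(** The value Gamma(h) J(h) is at most Gamma(h) h = Gamma(h + 1) <= 1. *)
Let conv_gtail_le1 (h : R) : (0 < h <= 1)%R -> conv gsum (gtail h) t <= 1.
Proof.
move=> /andP[h0 h1]; rewrite conv_gtail//.
apply: (@le_trans _ _ ((Gamma h)%:E * h%:E)).
  by rewrite lee_wpmul2l ?J_le// lee_fin ltW// Gamma_gt0.
by rewrite -EFinM mulrC -Gammaj1// lee_fin Gammaj1_le1// h0.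
Qed.

(** Monotone convergence: weights increasing to 1 bring [gtail 0] below [gtail h] with h = 1/(n+1),
    for which the bound is known. *)
Let conv_gtail0_le1 : conv gsum (gtail 0) t <= 1.
Proof.
(* For y > 1 the powers y^(1/(n+1)) decrease; truncating y at 1 makes the sequence nondecreasing for
   every y. *)
pose w (n : nat) (y : R) : R := (Num.min y 1 `^ (n.+1%:R^-1))%R.
have m0 (y : R) : (0 < y)%R -> (0 < Num.min y 1)%R by move=> y0; rewrite lt_min y0/=.
pose f (n : nat) (u : R) := gsum u * ((w n (t - u))%:E * gtail 0 (t - u)%R).
have f0 n u : 0 <= f n u.
  by rewrite !mule_ge0 ?gsum_ge0 ?gtail_ge0// lee_fin powR_ge0.
have mf n : measurable_fun [set: R] (f n).
  apply: (@mint (fun y => (w n y)%:E * gtail 0 y)).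
  apply: emeasurable_funM; last exact: measurable_gtail.
  apply/measurable_EFinP; apply: (measurableT_comp (measurable_powR _)).
  exact: measurable_minr.
have nd u n m : (n <= m)%N -> f n u <= f m u.
  move=> nm; rewrite /f lee_wpmul2l ?gsum_ge0//.
  have [y0|y0] := ltP 0%R (t - u)%R; last by rewrite gtail_le0// !mule0.
  rewrite lee_wpmul2r ?gtail_ge0// lee_fin /w ger_powR//.
    by rewrite m0//= ge_min lexx orbT.
  by rewrite lef_pV2 ?posrE// ler_nat.
have lim u : f n u @[n --> \oo] --> gsum u * gtail 0 (t - u)%R.
  have [y0|y0] := ltP 0%R (t - u)%R; last first.
    rewrite gtail_le0// mule0 (_ : (fun n => _) = fun=> 0); first exact: cvg_cst.
    by apply/funext => n; rewrite /f gtail_le0// !mule0.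
  rewrite (_ : (fun n => _) =
      fun n => (w n (t - u)%R)%:E * (gsum u * gtail 0 (t - u)%R)); last first.
    by apply/funext => n; rewrite /f muleCA.
  have w1 : (w n (t - u))%:E @[n --> \oo] --> 1.
    apply: cvg_EFin; first by near=> n.
    exact: cvg_powR_harmonic (m0 _ y0).
  rewrite -[X in _ --> X]mul1e; apply: (cvgeM _ w1 (cvg_cst _)).
  by rewrite /mule_def oner_eq0; case: (_ * _).
have -> : conv gsum (gtail 0) t = limn (fun n => \int[mu]_u f n u).
  rewrite -monotone_convergence//.
    by apply: eq_integral => u _; apply/esym/cvg_lim => //; exact: lim.
  by move=> u _ n m nm; exact: nd.
apply: lime_le.
  apply: ereal_nondecreasing_is_cvgn => n m nm; apply: ge0_le_integral => //.
  - exact: mf.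
  - exact: mf.
  - by move=> u _; exact: nd.
near=> n.
have n1 : (0 < (n.+1%:R^-1 : R) <= 1)%R by rewrite invr_gt0 ltr0n/= invf_le1 ?ler1n.
apply: le_trans (conv_gtail_le1 n1); apply: ge0_le_integral => //.
- exact: mf.
- by apply: mint; exact: measurable_gtail.
move=> u _; rewrite lee_wpmul2l ?gsum_ge0//.
have [y0|y0] := ltP 0%R (t - u)%R; last by rewrite !gtail_le0// mule0.
apply: le_trans (gtail0_le _ y0); last by rewrite invr_ge0.
rewrite lee_wpmul2r ?gtail_ge0// lee_fin /w ge0_ler_powR ?nnegrE ?invr_ge0//.
- exact/ltW/m0.
- exact: ltW.
- by rewrite ge_min lexx.
Unshelve. all: by end_near. Qed.

(** The missing inequality 1 <= L follows from 1 <= L + O(h) for small h, with an explicit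
    constant. *)
Lemma conv_gsum_gtail0 : conv gsum (gtail 0) t = 1.
Proof.
set L := conv gsum (gtail 0) t.
have L0 : 0 <= L by apply: conv_ge0 => ?; [exact: gsum_ge0|exact: gtail_ge0].
have LE : (fine L)%:E = L.
  by rewrite fineK// ge0_fin_numE// (le_lt_trans conv_gtail0_le1)// ltry.
set A := conv gsum hstep t.
have A0 : 0 <= A by apply: conv_ge0 => ?; [exact: gsum_ge0|exact: hstep_ge0].
have AE : (fine A)%:E = A by rewrite fineK// ge0_fin_numE// conv_gsum_hstep_lty.
have [G G0 GammaG] : exists2 G : R, (0 < G)%R &
    forall h : R, (0 < h)%R -> (1 - h * G <= h * Gamma h)%R.
  exists (2 * Gamma 2^-1)%R => [|h h0]; first by rewrite mulr_gt0// Gamma_gt0.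
  have := Gammaj1_ge h0; rewrite (Gammaj1 h0).
  by move: (Gamma _) (Gamma _) => g1 g2; lra.
have [C C0 Q] : exists2 C : R, (0 < C)%R & forall s : R, (0 < s <= 1)%R ->
    (s * G <= 2^-1)%R -> 1 - (s * C)%:E <= conv (gpdf s) hstep t.
  have [tau tau0 tauE] : exists2 tau : R, (0 <= tau)%R & gtail 0 t = tau%:E.
    exists (fine (gtail 0 t)); first by rewrite fine_ge0// gtail_ge0.
    by rewrite fineK// ge0_fin_numE ?gtail0_lty// gtail_ge0.
  (* The tail at t is at most (tau + s) / Gamma(s), and s Gamma(s) >= 1 - s G >= 1/2, so it is at
     most 2 (tau + 1) s. *)
  exists (2 * (tau + 1))%R => [|s s01 sG]; first by rewrite mulr_gt0// ltr_wpDl.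
  have s0 : (0 < s)%R by case/andP: s01.
  have : hstep t = conv (gpdf s) hstep t + tail (gpdf s) t.
    apply: hstepE; [exact: measurable_gpdf|exact: gpdf_ge0| |exact: integral_gpdf].
    by move=> x; exact: gpdf_le0.
  rewrite {1}/hstep t0 => E; rewrite leeBlDr// [leLHS]E leeD2l//.
  rewrite (tail_gpdf _ s0).
  have Gs := Gamma_gt0 s0.
  apply: (@le_trans _ _ (((Gamma s)^-1)%:E * (gtail 0 t + s%:E * hstep t))).
    by rewrite lee_wpmul2l ?(gtail_le _ s01)// lee_fin invr_ge0 ltW.
  rewrite tauE /hstep t0 mule1 -EFinD -EFinM lee_fin.
  have := GammaG _ s0; move: (Gamma s) Gs => g g0 sg.
  rewrite mulrC ler_pdivrMr//.
  have s1 : (s <= 1)%R by case/andP: s01.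
  have : (0 <= (s * g - 2^-1) * (tau + 1))%R by rewrite mulr_ge0 ?subr_ge0 ?addr_ge0//; lra.
  nra.
(* Two bounds on Gamma(h) J(h) are compared: it is at least (1 - h G)(1 - h C), because P_s(t) >= 1
   - h C for s <= h, and at most L + h A by [gtail_le]. *)
have key (h : R) : (0 < h <= 1)%R -> (h * G <= 2^-1)%R -> (h * C <= 1)%R ->
    (1 <= fine L + h * (fine A + C + G))%R.
  move=> /andP[h0 h1] hG hC.
  have J_ge : (h * (1 - h * C))%:E <= J h.
    rewrite mulrC EFinM [X in _ * X](_ : h%:E = mu `]0%R, h]); last first.
      by rewrite lebesgue_measure_itv/= lte_fin h0 -EFinB subr0.
    rewrite -integral_cst//; apply: ge0_le_integral => //.
    - by move=> s _; rewrite lee_fin subr_ge0.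
    - exact: mP.
    move=> s /=; rewrite in_itv/= => /andP[s0 sh].
    apply: le_trans (Q s _ _).
    - by rewrite EFinB leeB// lee_fin ler_pM2r.
    - by rewrite s0 (le_trans sh).
    - by apply: le_trans hG; rewrite ler_pM2r.
  have mA : measurable_fun [set: R] (fun u : R => gsum u * hstep (t - u)%R).
    by apply: mint; exact: measurable_hstep.
  have mL : measurable_fun [set: R] (fun u : R => gsum u * gtail 0 (t - u)%R).
    by apply: mint; exact: measurable_gtail.
  have pA u : 0 <= gsum u * hstep (t - u)%R by rewrite mule_ge0 ?gsum_ge0 ?hstep_ge0.
  have pL u : 0 <= gsum u * gtail 0 (t - u)%R by rewrite mule_ge0 ?gsum_ge0 ?gtail_ge0.
  have up : (Gamma h)%:E * J h <= L + h%:E * A.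
    rewrite -conv_gtail// /L /A /conv -ge0_integralZl ?lee_fin ?(ltW h0)//.
    rewrite -ge0_integralD//; last 2 first.
    - by move=> u _; rewrite mule_ge0 ?pA// lee_fin ltW.
    - exact: measurable_funeM.
    apply: ge0_le_integral.
    - exact: measurableT.
    - by move=> u _; rewrite mule_ge0 ?gsum_ge0 ?gtail_ge0.
    - by apply: mint; exact: measurable_gtail.
    - by apply: emeasurable_funD => //; exact: measurable_funeM.
    move=> u _; rewrite muleCA -ge0_muleDr ?gtail_ge0//; last first.
      by rewrite mule_ge0 ?hstep_ge0// lee_fin ltW.
    by rewrite lee_wpmul2l ?gsum_ge0// gtail_le// h0.
  have Gh := Gamma_gt0 h0.
  have : (Gamma h * (h * (1 - h * C)) <= fine L + h * fine A)%R.
    rewrite -lee_fin EFinM EFinD [(h * fine A)%:E]EFinM LE AE; apply: le_trans up.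
    by rewrite lee_wpmul2l// lee_fin ltW.
  have := GammaG _ h0; move: (Gamma h) Gh => g g0 a b.
  have : (0 <= (h * g - (1 - h * G)) * (1 - h * C))%R by rewrite mulr_ge0 ?subr_ge0.
  have : (0 <= (h * G) * (h * C))%R.
    by exact: mulr_ge0 (mulr_ge0 (ltW h0) (ltW G0)) (mulr_ge0 (ltW h0) (ltW C0)).
  nra.
apply/eqP; rewrite eq_le conv_gtail0_le1/= -/L -LE lee_fin leNgt; apply/negP => L1.
pose M : R := (fine A + C + G)%R.
have M0 : (0 < M)%R by rewrite ltr_pwDr// addr_ge0 ?fine_ge0 ?(ltW C0).
have d0 : (0 < (1 - fine L) / (2 * M))%R by rewrite divr_gt0 ?subr_gt0 ?mulr_gt0.
(* The first three terms are the conditions of [key]; the last one makes the error h M at most half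
   of the gap 1 - L. *)
pose h : R := (Num.min (Num.min 1 (2 * G)^-1) (Num.min C^-1 ((1 - fine L) / (2 * M))))%R.
have h0 : (0 < h)%R by rewrite !lt_min ltr01 !invr_gt0 C0 d0 mulr_gt0.
have : (h <= h)%R by [].
rewrite {2}/h !le_min => /andP[/andP[h1 hG] /andP[hC hM]].
have := key h; rewrite h0 h1 -/M => /(_ isT).
have -> : (h * G <= 2^-1)%R.
  by rewrite -ler_pdivlMr// (le_trans hG)// invfM mulrC.
have -> : (h * C <= 1)%R by rewrite -ler_pdivlMr// mul1r.
move=> /(_ isT isT).
have : (h * M <= (1 - fine L) / 2)%R.
  by rewrite -ler_pdivlMr// (le_trans hM)// invfM mulrA.
lra.
Qed.

End fixed_time.
End conv_gsum_tail.

(** * Finiteness of the kernels and rescaling by alpha *)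

Section gsum_finite.
Context {R : realType}.
Local Notation mu := (@lebesgue_measure R).
Local Open Scope ereal_scope.

(** A bound uniform in s, also as s -> 0: u^(s-1) <= u^-1 + 1 by [powR_le_onem], and 1 / Gamma(s) <=
    e^3 by [Gam_ge] with |s - 1| <= 1. *)
Lemma gpdf_le_bound (s u : R) : (0 < s <= 1)%R -> (0 < u)%R ->
  gpdf s u <= ((u^-1 + 1) * expR 3)%:E.
Proof.
move=> /andP[s0 s1] u0; rewrite /gpdf s0 lee_fin.
have Gs : (expR (- 3) <= Gamma s)%R.
  rewrite -lee_fin -GamE//; apply: le_trans (Gam_ge s); rewrite lee_fin ler_expR.
  by rewrite ler0_norm ?subr_le0//; lra.
rewrite ler_pM ?gam_ge0 ?invr_ge0 ?(ltW (Gamma_gt0 s0))//.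
  rewrite /gam /tpow u0; apply: (@le_trans _ _ (u `^ (s - 1)))%R.
    by rewrite ler_piMr ?powR_ge0// expR_le1 oppr_le0 ltW.
  have un0 : (u != 0)%R by rewrite gt_eqF.
  rewrite powRB ?un0 ?implybT// powRr1 ?(ltW u0)// ler_pdivrMr// mulrDl mulVf// mul1r.
  have hs : (0 <= s <= 1)%R by rewrite ltW.
  by have := powR_le_onem hs u0; nra.
rewrite -[leRHS]invrK -expRN lef_pV2// posrE ?expR_gt0//.
exact: Gamma_gt0.
Qed.

Lemma measurable_gpdfr (u : R) : measurable_fun [set: R] (fun s : R => gpdf s u).
Proof. exact: (measurableT_comp measurable_gpdf2 (measurable_pair2 u)). Qed.

Lemma gpdf1_le (u : R) : gpdf 1 u <= hstep u.
Proof.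
rewrite /gpdf /hstep ltr01 Gamma1 divr1 /gam /tpow; case: ifPn => u0; last by rewrite mul0r.
by rewrite subrr powRr0 mul1r lee_fin expR_le1 oppr_le0 ltW.
Qed.

(* The part [s > 1] of the integral is a convolution with [gpdf 1], which is at most
   1, so that it is controlled by the primitive of [gsum]. *)
Lemma gsum_lty (u : R) : gsum u < +oo.
Proof.
have [u0|u0] := ltP 0%R u; last by rewrite gsum_le0.
have m1 : measurable_fun [set: R] (fun s : R => if (s <= 1)%R then gpdf s u else 0).
  by apply: measurable_fun_ifT => //; [exact: measurable_fun_ler|exact: measurable_gpdfr].
have m2 : measurable_fun [set: R] (fun s : R => if (1 < s)%R then gpdf s u else 0).
  by apply: measurable_fun_ifT => //; [exact: measurable_fun_ltr|exact: measurable_gpdfr].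
have -> : gsum u = \int[mu]_s (if (s <= 1)%R then gpdf s u else 0) +
    \int[mu]_s (if (1 < s)%R then gpdf s u else 0).
  rewrite -ge0_integralD//.
  - by apply: eq_integral => s _; case: leP => _; rewrite ?adde0 ?add0e.
  - by move=> s _; case: ifP => // _; exact: gpdf_ge0.
  - by move=> s _; case: ifP => // _; exact: gpdf_ge0.
apply: lte_add_pinfty.
  apply: (@le_lt_trans _ _ (\int[mu]_(s in `]0%R, 1%R]) cst ((u^-1 + 1) * expR 3)%:E s)).
    rewrite (@integral_mkif _ `]0%R, 1%R]%classic (fun s => (0 < s) && (s <= 1))%R); last first.
      by apply/seteqP; split => x /=; rewrite in_itv/=.
    have mp : measurable_fun [set: R] (fun s : R => (0 < s) && (s <= 1))%R.
      by apply: measurable_and; [exact: measurable_fun_ltr|exact: measurable_fun_ler].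
    apply: ge0_le_integral.
    - exact: measurableT.
    - by move=> s _; case: ifP => // _; exact: gpdf_ge0.
    - exact: m1.
    - exact: (measurable_fun_ifT mp (measurable_cst _) (measurable_cst 0)).
    move=> s _; have [s0|s0] := ltP 0%R s; last by rewrite /gpdf ltNge s0/= if_same.
    by case: ifPn => s1 //=; apply: gpdf_le_bound => //; rewrite s0.
  by rewrite integral_cst//= lebesgue_measure_itv/= lte01 oppr0 adde0 mule1 ltry.
apply: le_lt_trans (conv_gsum_hstep_lty u).
have -> : \int[mu]_s (if (1 < s)%R then gpdf s u else 0) = conv gsum (gpdf 1) u.
  rewrite conv_gsum; [|exact: measurable_gpdf|exact: gpdf_ge0].
  rewrite -(ge0_integral_translate 1 m2); last by move=> s; case: ifP => // _; exact: gpdf_ge0.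
  apply: eq_integral => s _; rewrite ltrDr; case: ifPn => s0.
    by rewrite conv_gpdf.
  by rewrite (@conv_gpdf_le0 _ s)// leNgt.
apply: ge0_le_integral.
- exact: measurableT.
- by move=> v _; exact: mule_ge0 (gsum_ge0 _) (gpdf_ge0 _ _).
- apply: emeasurable_funM; first exact: measurable_gsum.
  by apply: measurable_reflect; exact: measurable_gpdf.
- apply: emeasurable_funM; first exact: measurable_gsum.
  by apply: measurable_reflect; exact: measurable_hstep.
- by move=> v _; rewrite lee_wpmul2l ?gsum_ge0 ?gpdf1_le.
Qed.

Lemma gsum_fin_num (u : R) : gsum u \is a fin_num.
Proof. by rewrite ge0_fin_numE ?gsum_lty ?gsum_ge0. Qed.

Lemma gtail0_fin_num (y : R) : gtail 0 y \is a fin_num.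
Proof. by rewrite ge0_fin_numE ?gtail0_lty ?gtail_ge0. Qed.

Lemma Skernel_gsum (u : R) : (0 < u)%R -> Skernel u = fine (gsum u).
Proof.
move=> u0; rewrite /Skernel /Rintegral.
have -> : gsum u = (expR (- u))%:E *
    \int[mu]_(s in `]0%R, +oo[) (u `^ (s - 1) / Gamma s)%:E.
  pose p (s : R) := (0 < s)%R.
  rewrite (@integral_mkif _ `]0%R, +oo[%classic p); last first.
    by apply/seteqP; split => x /=; rewrite in_itv/= andbT.
  have E s : gpdf s u = (expR (- u))%:E * (if p s then (u `^ (s - 1) / Gamma s)%:E else 0).
    rewrite /gpdf /p; case: ifPn => s0; last by rewrite mule0.
    by rewrite /gam /tpow u0 -EFinM; congr EFin; ring.
  rewrite -ge0_integralZl.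
  - by apply: eq_integral => s _; exact: E.
  - exact: measurableT.
  - rewrite (_ : (fun s => _) = fun s => (expR u)%:E * gpdf s u).
      by apply: measurable_funeM; exact: measurable_gpdfr.
    by apply/funext => s; rewrite E muleA -EFinM expRxMexpNx_1 mul1e.
  - move=> s _; rewrite /p; case: ifPn => // s0.
    by rewrite lee_fin divr_ge0 ?powR_ge0// ltW// Gamma_gt0.
  - by rewrite lee_fin expR_ge0.
(* If the integral is infinite, [fine] gives 0 on both sides, so the factor passes through [fine] in
   every case. *)
move: (\int[mu]_(s in _) _) => -[r| |]//=.
- by rewrite gt0_muley ?lte_fin ?expR_gt0//= mulr0.
- by rewrite gt0_muleNy ?lte_fin ?expR_gt0//= mulr0.
Qed.

Lemma E1_gtail (y : R) : (0 < y)%R -> E1 y = fine (gtail 0 y).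
Proof.
move=> y0; rewrite /E1 /Rintegral gtailE//; congr fine.
rewrite (@integral_mkif _ `[y, +oo[%classic (fun v => (y <= v)%R)); last first.
  by apply/seteqP; split => x /=; rewrite in_itv/= andbT.
apply: eq_integral => v _; case: ifPn => // yv; congr EFin.
have v0 : (0 < v)%R by exact: lt_le_trans yv.
by rewrite /gam /tpow v0 sub0r powR_inv1 ?(ltW v0)// mulrC.
Qed.

(** Real-valued, to be convolved with the signed function f; [gsum_fin_num] and [gtail0_fin_num]
    show that [fine] loses nothing here and in [scaledE1]. *)
Definition scaledS (alpha v : R) : R := fine (gsum (v / alpha)).
Definition scaledE1 (alpha v : R) : R := fine (gtail 0 (v / alpha)).

Lemma scaledS_ge0 alpha v : (0 <= scaledS alpha v)%R.
Proof. by rewrite fine_ge0// gsum_ge0. Qed.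

Lemma scaledE1_ge0 alpha v : (0 <= scaledE1 alpha v)%R.
Proof. by rewrite fine_ge0// gtail_ge0. Qed.

Lemma scaledS_le0 (alpha v : R) : (0 < alpha)%R -> (v <= 0)%R -> scaledS alpha v = 0%R.
Proof. by move=> a0 v0; rewrite /scaledS gsum_le0// pmulr_lle0// invr_gt0. Qed.

Lemma scaledE1_le0 (alpha v : R) : (0 < alpha)%R -> (v <= 0)%R -> scaledE1 alpha v = 0%R.
Proof. by move=> a0 v0; rewrite /scaledE1 gtail_le0// pmulr_lle0// invr_gt0. Qed.

Lemma measurable_scaledS alpha : measurable_fun [set: R] (scaledS alpha).
Proof.
apply: measurableT_comp => //; apply: (measurableT_comp measurable_gsum).
exact: measurable_funM.
Qed.

Lemma measurable_scaledE1 alpha : measurable_fun [set: R] (scaledE1 alpha).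
Proof.
apply: measurableT_comp => //; apply: (measurableT_comp (measurable_gtail 0)).
exact: measurable_funM.
Qed.

Lemma conv_scaled (k l : R -> \bar R) (alpha x : R) : (0 < alpha)%R ->
  measurable_fun [set: R] k -> (forall x, 0 <= k x) ->
  measurable_fun [set: R] l -> (forall x, 0 <= l x) ->
  conv (fun v => k (v / alpha)%R) (fun v => l (v / alpha)%R) x =
  alpha%:E * conv k l (x / alpha).
Proof.
move=> a0 mk k0 ml l0; rewrite /conv.
have ms : measurable_fun [set: R] (fun v : R => v / alpha)%R by exact: measurable_funM.
rewrite (ge0_integral_affine 0 a0); first 1 last.
- apply: emeasurable_funM; first exact: (measurableT_comp mk ms).
  by apply: (@measurable_reflect R (fun v => l (v / alpha)%R)); exact: (measurableT_comp ml ms).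
- by move=> u; exact: mule_ge0.
congr (_ * _); apply: eq_integral => u _; congr (k _ * l _).
  by rewrite addr0 mulrAC divff ?mul1r// gt_eqF.
by field; rewrite gt_eqF.
Qed.

(** The factor [alpha] comes from the change of variable and cancels the [alpha^-1] in [Jop]. *)
Lemma conv_scaledS_scaledE1 (alpha x : R) : (0 < alpha)%R ->
  conv (EFin \o scaledS alpha) (EFin \o scaledE1 alpha) x = alpha%:E * hstep x.
Proof.
move=> a0.
rewrite (_ : EFin \o scaledS alpha = fun v => gsum (v / alpha)%R); last first.
  by apply/funext => v /=; rewrite fineK// gsum_fin_num.
rewrite (_ : EFin \o scaledE1 alpha = fun v => gtail 0 (v / alpha)%R); last first.
  by apply/funext => v /=; rewrite fineK// gtail0_fin_num.
rewrite conv_scaled//; [|exact: measurable_gsum|exact: gsum_ge0|exact: measurable_gtail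
  |exact: gtail_ge0].
congr (_ * _); rewrite /hstep; case: ifPn => x0.
  by rewrite conv_gsum_gtail0// divr_gt0.
have xa : (x / alpha <= 0)%R by rewrite pmulr_lle0 ?invr_gt0// leNgt.
apply: integral0_eq => u _; have [u0|u0] := leP u 0%R; first by rewrite gsum_le0// mul0e.
by rewrite gtail_le0 ?mule0//; lra.
Qed.

Lemma conv_scaledS_hstep_lty (alpha x : R) : (0 < alpha)%R ->
  conv (EFin \o scaledS alpha) hstep x < +oo.
Proof.
move=> a0.
rewrite (_ : EFin \o scaledS alpha = fun v => gsum (v / alpha)%R); last first.
  by apply/funext => v /=; rewrite fineK// gsum_fin_num.
rewrite (_ : hstep = fun v => hstep (v / alpha)%R); last first.
  by apply/funext => v; rewrite /hstep pmulr_lgt0// invr_gt0.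
rewrite conv_scaled//; [|exact: measurable_gsum|exact: gsum_ge0|exact: measurable_hstep
  |exact: hstep_ge0].
rewrite lte_mul_pinfty// ?lee_fin ?(ltW a0)//.
exact: conv_gsum_hstep_lty.
Qed.

End gsum_finite.

(** * Absolute continuity of primitives *)

Section absolute_continuity.
Context {R : realType}.
Local Notation mu := (@lebesgue_measure R).
Implicit Types (a b : R) (f F G : R -> R).

Definition primitive f (x : R) : R := \int[mu]_(t in `]-oo, x]) f t.

Lemma integrable_itv f (i : interval R) :
  mu.-integrable [set: R] (EFin \o f) -> mu.-integrable [set` i] (EFin \o f).
Proof. by apply: integrableS => //; exact: measurable_itv. Qed.

Lemma primitiveB f u v : mu.-integrable [set: R] (EFin \o f) -> u <= v ->
  primitive f v - primitive f u = \int[mu]_(t in `]u, v]) f t.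
Proof.
by move=> intf uv; rewrite /primitive Rintegral_itvB//; exact: integrable_itv.
Qed.

(** Absolute continuity of the integral of |f|, applied to the union [D] of the intervals, whose
    measure is their total length. *)
Lemma abs_continuous_primitive a b f :
  mu.-integrable [set: R] (EFin \o f) -> abs_continuous a b (primitive f).
Proof.
move=> intf e e0.
have [d [d0 H]] := integral_normr_continuous intf e0.
exists d => // n u v uv tI sd.
pose A i := `]u i, v i[%classic.
pose D := \big[setU/set0]_(i < n) A i.
have mA i : measurable (A i) by exact: measurable_itv.
have mD : measurable D by exact: bigsetU_measurable.
have intn : mu.-integrable [set: R] (EFin \o (Num.norm \o f)) by exact: integrable_norm.
have muD : (mu D < d%:E)%E.
  rewrite /D measure_bigsetU_ord// (eq_bigr (fun i => (v i - u i)%:E)); last first.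
    move=> i _; rewrite -[LHS]/(mu `]u i, v i[%classic) lebesgue_measure_itv/= lte_fin.
    have [_ + _] := uv i; rewrite le_eqVlt => /predU1P[->|->]; last by rewrite EFinB.
    by rewrite ltxx subrr.
  by rewrite sumEFin lte_fin.
apply: le_lt_trans (H D mD muD).
rewrite /Rintegral ge0_integral_bigsetU//; last 3 first.
- exact: index_enum_uniq.
- by apply: sub_trivIset tI.
- by apply: measurable_funTS; exact: (measurable_int _ intn).
rewrite -sum_fine; last first.
  move=> i _; apply: (@integrable_fin_num _ _ _ mu (A i) (mA i) (EFin \o (Num.norm \o f))).
  exact: (integrable_itv `]u i, v i[ intn).
apply: ler_sum => i _; have [_ uvi _] := uv i.
(* Increments are integrals over ]u, v], whereas disjointness is assumed for the open intervals; the
   endpoint is dropped. *)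
rewrite primitiveB//
  -(@Rintegral_itv_bndo_bndc _ (BRight (u i)) (v i)); last exact: integrable_itv.
by apply: le_normr_Rintegral => //; exact: integrable_itv.
Qed.

Lemma abs_continuous1 a b F (e : R) : abs_continuous a b F -> 0 < e ->
  exists2 d : R, 0 < d & forall x y, a <= x -> x <= y -> y <= b -> y - x < d ->
    `|F y - F x| < e.
Proof.
move=> acF e0; have [d d0 H] := acF _ e0; exists d => // x y ax xy yb yxd.
have := H 1%N (fun=> x) (fun=> y); rewrite !big_ord1; apply => //.
by move=> i j _ _ _; rewrite (ord1 i) (ord1 j).
Qed.

(** By continuity, x is approached from the right through points outside the null set; hence the
    exclusion of b. *)
Lemma abs_continuous_ae_eq a b F G : abs_continuous a b F -> abs_continuous a b G ->
  {ae mu, forall x, x \in `[a, b] -> F x = G x} ->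
  forall x, a <= x < b -> F x = G x.
Proof.
move=> acF acG [N [mN N0 FGN]] x /andP[ax xb].
apply/eqP; rewrite -subr_eq0 -normr_le0; apply/ler_addgt0Pr => e e0; rewrite add0r.
have e2 : 0 < e / 2 by rewrite divr_gt0.
have [d1 d10 H1] := abs_continuous1 acF e2.
have [d2 d20 H2] := abs_continuous1 acG e2.
pose d := Num.min (Num.min d1 d2) (b - x).
have d0 : 0 < d by rewrite !lt_min d10 d20 subr_gt0.
(* The interval ]x, x + d[ has positive measure, so it is not contained in [N]. *)
have [y [/andP[xy yd] yN]] : exists y, x < y < x + d /\ ~ N y.
  apply: contrapT => H.
  have sub : `]x, x + d[%classic `<=` N.
    move=> y /=; rewrite in_itv/= => xyd; apply: contrapT => Ny.
    by apply: H; exists y.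
  have : (mu `]x, (x + d)%R[ <= mu N)%E.
    by apply: le_measure; rewrite ?inE.
  rewrite N0 lebesgue_measure_itv/= lte_fin ltrDl d0 -EFinB lee_fin.
  by rewrite addrAC subrr add0r leNgt d0.
have : d <= d by [].
rewrite {2}/d !le_min => /andP[/andP[dd1 dd2] dbx].
have yb : y <= b by lra.
have FGy : F y = G y.
  apply: contrapT => FGy; apply: yN; apply: FGN => /= /(_ _)/FGy; apply.
  by rewrite in_itv/= yb andbT; lra.
have B1 := H1 x y ax (ltW xy) yb.
have B2 := H2 x y ax (ltW xy) yb.
rewrite (_ : F x - G x = (G y - G x) - (F y - F x)); last by rewrite FGy; lra.
rewrite (le_trans (ler_normB _ _))// [leRHS]splitr lerD// ltW//.
- by apply: B2; lra.
- by apply: B1; lra.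
Qed.

End absolute_continuity.

(** * Fractional integrals of integrable functions *)

Section signed_convolution.
Context {R : realType}.
Local Notation mu := (@lebesgue_measure R).
Local Open Scope ereal_scope.

Lemma measurable_integralr (G : R * R -> \bar R) : measurable_fun [set: R * R] G ->
  measurable_fun [set: R] (fun t : R => \int[mu]_r G (t, r)).
Proof.
move=> mG.
have -> : (fun t : R => \int[mu]_r G (t, r)) =
    fun t => \int[mu]_r G^\+ (t, r) - \int[mu]_r G^\- (t, r).
  apply/funext => t; rewrite integralE.
  by congr (_ - _); apply: eq_integral => r _;
    rewrite (funeposE, funenegE) (funeposE, funenegE).
apply: emeasurable_funB.
- exact: (@measurable_fun_fubini_tonelli_F _ _ _ _ R mu _
    (measurable_funepos mG) (funepos_ge0 G)).
- exact: (@measurable_fun_fubini_tonelli_F _ _ _ _ R mu _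
    (measurable_funeneg mG) (funeneg_ge0 G)).
Qed.

Variables (k m f : R -> R).
Hypotheses (mk : measurable_fun [set: R] k) (k0 : forall u, (0 <= k u)%R).
Hypotheses (mm : measurable_fun [set: R] m) (m0 : forall u, (0 <= m u)%R).
Hypothesis mf : measurable_fun [set: R] f.

(** Where the integral diverges this is a default value; [aeF] shows that, after weighting by
    [m (x - t)], this concerns only a null set of t. *)
Definition rconv (t : R) : R := fine (\int[mu]_r (k (t - r) * f r)%:E).

Lemma measurable_rconv : measurable_fun [set: R] rconv.
Proof.
apply: measurableT_comp => //.
apply: (measurable_integralr (G := fun z => (k (z.1 - z.2) * f z.2)%:E)).
apply/measurable_EFinP; apply: measurable_funM; apply: measurableT_comp => //.
exact: measurable_funB.
Qed.

Variable x : R.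
Hypothesis fin : \int[mu]_r (`|f r|%:E * conv (EFin \o k) (EFin \o m) (x - r)%R) < +oo.

Let F (z : R * R) : \bar R := (m (x - z.1) * (k (z.1 - z.2) * f z.2))%:E.

Let mF : measurable_fun [set: R * R] F.
Proof.
apply/measurable_EFinP; apply: measurable_funM.
  by apply: measurableT_comp => //; exact: measurable_funB.
apply: measurable_funM; apply: measurableT_comp => //.
exact: measurable_funB.
Qed.

(** The integral may be +oo while [c] has any sign, so [c] is pulled out separately for each
    sign. *)
Let convE (r c : R) : \int[mu]_t (m (x - t) * (k (t - r) * c))%:E =
  c%:E * conv (EFin \o k) (EFin \o m) (x - r)%R.
Proof.
have mkm : measurable_fun [set: R] (fun t : R => (k (t - r) * m (x - t))%:E).
  apply/measurable_EFinP; apply: measurable_funM; apply: measurableT_comp => //;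
  exact: measurable_funB.
have km0 t : 0 <= (k (t - r) * m (x - t))%:E by rewrite lee_fin mulr_ge0.
have -> : conv (EFin \o k) (EFin \o m) (x - r)%R = \int[mu]_t (k (t - r) * m (x - t))%:E.
  rewrite -(ge0_integral_translate r mkm km0).
  by apply: eq_integral => t _ /=; rewrite addrK opprD addrA addrAC -EFinM.
have [cp|cn] := leP 0%R c.
  rewrite -ge0_integralZl//; apply: eq_integral => t _.
  by rewrite -EFinM; congr EFin; ring.
transitivity (\int[mu]_t (- ((- c)%:E * (k (t - r) * m (x - t))%:E))).
  by apply: eq_integral => t _; rewrite -EFinM -EFinN; congr EFin; ring.
rewrite integral_ge0N.
  by rewrite ge0_integralZl// ?lee_fin ?oppr_ge0 ?(ltW cn)// EFinN mulNe oppeK.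
by move=> t _; rewrite mule_ge0// lee_fin oppr_ge0 ltW.
Qed.

(** Integrating |F| in t first gives, by [convE], the integrand of [fin]; so [fin] is exactly the
    integrability of [F]. *)
Let intF : (mu \x mu)%E.-integrable [set: R * R] F.
Proof.
apply/(integrable21ltyP mu mu mF); apply: le_lt_trans fin.
rewrite le_eqVlt; apply/orP; left; apply/eqP; apply: eq_integral => r _.
rewrite -convE; apply: eq_integral => t _; rewrite /F/=.
by rewrite !normrM (ger0_norm (m0 _)) (ger0_norm (k0 _)).
Qed.

(** Fubini makes almost every section of [F] integrable. Where [m (x - t)] vanishes both sides are
    0; elsewhere dividing by it makes the integral in [rconv] finite. *)
Let aeF : {ae mu, forall t, [set: R] t ->
  \int[mu]_r F (t, r) = (m (x - t) * rconv t)%:E}.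
Proof.
have := ae_integrable1 intF; apply: filterS => t intFt _.
have [mt|mt] := eqVneq (m (x - t)%R) 0%R.
  by rewrite mt mul0r; apply: integral0_eq => r _; rewrite /F/= mt mul0r.
have intk : mu.-integrable [set: R] (fun r => (k (t - r) * f r)%:E).
  have := integrableZl measurableT (m (x - t))^-1 intFt.
  apply: eq_integrable => // r _; rewrite /F/= -EFinM.
  by rewrite mulKf.
transitivity ((m (x - t))%:E * \int[mu]_r (k (t - r) * f r)%:E).
  by rewrite -integralZl.
by rewrite EFinM /rconv fineK//; exact: integrable_fin_num.
Qed.

Let mmg : measurable_fun [set: R] (fun t : R => (m (x - t) * rconv t)%:E).
Proof.
apply/measurable_EFinP; apply: measurable_funM; last exact: measurable_rconv.
by apply: measurableT_comp => //; exact: measurable_funB.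
Qed.

Lemma integrable_rconv : mu.-integrable [set: R] (fun t => (m (x - t) * rconv t)%:E).
Proof.
have mFF := measurable_integralr mF.
have /integrableP[_ iF] := integrable_fubini_F intF.
apply/integrableP; split; first exact: mmg.
apply: le_lt_trans iF; rewrite le_eqVlt; apply/orP; left; apply/eqP.
apply: ge0_ae_eq_integral => //.
- exact: measurableT_comp.
- exact: measurableT_comp.
- move: aeF; apply: filterS; first exact: (ae_filter_ringOfSetsType mu).
  by move=> t /(_ I) E _; rewrite -E.
Qed.

Lemma integral_rconv : \int[mu]_t (m (x - t) * rconv t)%:E =
  \int[mu]_r ((f r)%:E * conv (EFin \o k) (EFin \o m) (x - r)%R).
Proof.
transitivity (\int[mu]_t \int[mu]_r F (t, r)).
  apply: ae_eq_integral => //; first exact: measurable_integralr.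
  move: aeF; apply: filterS; first exact: (ae_filter_ringOfSetsType mu).
  by move=> t /(_ I) E _; rewrite E.
by rewrite (Fubini intF); apply: eq_integral => r _; rewrite -convE.
Qed.

End signed_convolution.

(** * The two operators composed, and differentiation *)

Section fractional_integrals.
Context {R : realType}.
Local Notation mu := (@lebesgue_measure R).
Variables (a b alpha : R) (f : R -> R).
Hypotheses (alpha0 : 0 < alpha).
Hypothesis intf : mu.-integrable `[a, b] (EFin \o f).

Let fab : R -> R := f \_ `[a, b].

Let fabE r : a <= r <= b -> fab r = f r.
Proof. by move=> rab; rewrite /fab patchE mem_set//= in_itv. Qed.

Let fab_lt r : r < a -> fab r = 0.
Proof.
move=> ra; rewrite /fab patchE memNset//= in_itv/=.
by move=> /andP[/le_lt_trans/(_ ra)]; rewrite ltxx.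
Qed.

Lemma integrable_restr : mu.-integrable [set: R] (EFin \o fab).
Proof.
rewrite /fab -restrict_EFin; apply/integrable_restrict => //=.
by rewrite setTI.
Qed.

Let mfab : measurable_fun [set: R] fab.
Proof. by apply/measurable_EFinP; exact: (measurable_int mu integrable_restr). Qed.

Let intnf : (\int[mu]_r `|fab r|%:E < +oo)%E.
Proof. by have /integrableP[] := integrable_restr. Qed.

Let g := rconv (scaledS alpha) fab.

Lemma Sop_rconv t : a <= t <= b -> Sop a alpha f t = g t.
Proof.
move=> /andP[at_ tb]; rewrite /Sop /Rintegral /g /rconv; congr fine.
rewrite (@integral_mkif _ `[a, t[%classic (fun r => (a <= r) && (r < t))); last first.
  by apply/seteqP; split => x /=; rewrite in_itv/=.
apply: eq_integral => r _; case: ifPn => [/andP[ar rt]|].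
  rewrite fabE ?ar ?(le_trans (ltW rt))// /scaledS -Skernel_gsum//.
  by rewrite divr_gt0// subr_gt0.
rewrite negb_and -ltNge -leNgt => /orP[ra|tr]; first by rewrite fab_lt// mulr0.
by rewrite scaledS_le0 ?mul0r// subr_le0.
Qed.

Let g_lt t : t < a -> g t = 0.
Proof.
move=> ta; rewrite /g /rconv integral0_eq// => r _; have [ra|ar] := ltP r a.
  by rewrite fab_lt// mulr0.
by rewrite scaledS_le0 ?mul0r// subr_le0 (le_trans (ltW ta)).
Qed.

Let hs (u : R) : R := if 0 < u then 1 else 0.

Let hsE : EFin \o hs = hstep.
Proof. by apply/funext => u; rewrite /hstep /hs /=; case: ifP. Qed.

Let mhs : measurable_fun [set: R] hs.
Proof. by apply: measurable_fun_ifT => //; exact: measurable_fun_ltr. Qed.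

Let hs0 u : 0 <= hs u. Proof. by rewrite /hs; case: ifP. Qed.

Let mkS := measurable_scaledS alpha.
Let mkE := measurable_scaledE1 alpha.

(** [integrable_rconv] with a Heaviside weight seen from b + 1: since [hs] is 0 at 0, the point b +
    1 rather than b makes the weight 1 on all of [a, b]. *)
Lemma integrable_Sop : mu.-integrable `[a, b] (EFin \o Sop a alpha f).
Proof.
(* The integral of the scaled kernel up to b + 1 - a dominates those up to b + 1 - r for all r >=
   a. *)
pose A := conv (EFin \o scaledS alpha) hstep (b + 1 - a).
have A0 : (0 <= A)%E.
  by apply: conv_ge0 => ?; [rewrite lee_fin scaledS_ge0|exact: hstep_ge0].
have fin : (\int[mu]_r (`|fab r|%:E *
    conv (EFin \o scaledS alpha) (EFin \o hs) (b + 1 - r)%R) < +oo)%E.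
  rewrite hsE; apply: (@le_lt_trans _ _ (\int[mu]_r (`|fab r|%:E * A))%E).
    have mc : measurable_fun [set: R] (conv (EFin \o scaledS alpha) hstep).
      apply: measurable_conv;
        [by apply/measurable_EFinP| |exact: measurable_hstep|exact: hstep_ge0].
      by move=> u; rewrite lee_fin scaledS_ge0.
    have mn : measurable_fun [set: R] (fun r : R => (`|fab r|)%:E).
      by apply/measurable_EFinP; exact: measurableT_comp.
    apply: ge0_le_integral.
    - exact: measurableT.
    - move=> r _; rewrite mule_ge0// conv_ge0// => u; first by rewrite lee_fin scaledS_ge0.
      exact: hstep_ge0.
    - by apply: emeasurable_funM => //; exact: measurable_reflect.
    - by apply: emeasurable_funM.
    move=> r _; have [ra|ar] := ltP r a; first by rewrite fab_lt// normr0 !mul0e.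
    rewrite lee_wpmul2l//; apply: ge0_le_integral.
    - exact: measurableT.
    - by move=> u _; rewrite mule_ge0 ?hstep_ge0// lee_fin scaledS_ge0.
    - apply: emeasurable_funM; first by apply/measurable_EFinP.
      by apply: measurable_reflect; exact: measurable_hstep.
    - apply: emeasurable_funM; first by apply/measurable_EFinP.
      by apply: measurable_reflect; exact: measurable_hstep.
    move=> u _; rewrite lee_wpmul2l ?lee_fin ?scaledS_ge0// /hstep !subr_gt0.
    case: ifPn => [h1|_]; last by case: ifP.
    by rewrite ifT//; lra.
  rewrite ge0_integralZr//; first last.
    by apply/measurable_EFinP; exact: measurableT_comp.
  rewrite lte_mul_pinfty ?integral_ge0//.
  - by rewrite ge0_fin_numE// integral_ge0.
  - exact: conv_scaledS_hstep_lty.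
have I := integrable_rconv mkS (scaledS_ge0 alpha) mhs hs0 mfab fin.
have : mu.-integrable `[a, b] (fun t => (hs (b + 1 - t) * rconv (scaledS alpha) fab t)%:E).
  by apply: integrableS I => //; exact: measurable_itv.
apply: eq_integrable => [|t]; first exact: measurable_itv.
rewrite inE/= in_itv/= => tab; rewrite Sop_rconv// /hs ifT ?mul1r//.
by move: tab => /andP[]; lra.
Qed.

(** [integral_rconv] with the E1 kernel as weight: the combined kernel is [alpha] times a step
    function. Being bounded, it gives [fin] at every x, so the equality holds everywhere on
    [a, b]. *)
Lemma Jop_Sop x : a <= x <= b -> Jop a alpha (Sop a alpha f) x = primitive fab x.
Proof.
move=> /andP[ax xb].
have fin : (\int[mu]_r (`|fab r|%:E *
    conv (EFin \o scaledS alpha) (EFin \o scaledE1 alpha) (x - r)%R) < +oo)%E.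
  under eq_integral do rewrite conv_scaledS_scaledE1//.
  have mn : measurable_fun [set: R] (fun r : R => (`|fab r|)%:E).
    by apply/measurable_EFinP; exact: measurableT_comp.
  apply: (@le_lt_trans _ _ (\int[mu]_r (`|fab r|%:E * alpha%:E))%E).
    apply: ge0_le_integral.
    - exact: measurableT.
    - by move=> r _; rewrite !mule_ge0 ?hstep_ge0 ?lee_fin// ltW.
    - apply: emeasurable_funM => //; apply: measurable_funeM.
      by apply: measurable_reflect; exact: measurable_hstep.
    - exact: emeasurable_funM.
    move=> r _; rewrite lee_wpmul2l// /hstep; case: ifP => _; first by rewrite mule1.
    by rewrite mule0 lee_fin ltW.
  rewrite ge0_integralZr ?lee_fin ?(ltW alpha0)// lte_mul_pinfty ?ltry ?integral_ge0//.
  by rewrite ge0_fin_numE// integral_ge0.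
have E := integral_rconv mkS (scaledS_ge0 alpha) mkE (scaledE1_ge0 alpha) mfab fin.
have Fin : mu.-integrable [set: R] (fun r => (if r < x then fab r else 0)%:E).
  have : mu.-integrable [set: R] (EFin \o (fab \_ `]-oo, x[)).
    rewrite -restrict_EFin; apply/integrable_restrict => //=.
    by rewrite setTI; exact: integrable_itv integrable_restr.
  apply: eq_integrable => // r _; rewrite /= patchE.
  by rewrite (_ : (r \in _) = (r < x)); [case: ifP|apply/idP/idP; rewrite inE/= in_itv].
have J : (\int[mu]_(t in `[a, x[) (E1 ((x - t) / alpha) * Sop a alpha f t)%:E =
    alpha%:E * \int[mu]_r (if r < x then fab r else 0)%:E)%E.
  rewrite -integralZl//
    (@integral_mkif _ `[a, x[%classic (fun t => (a <= t) && (t < x))); last first.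
    by apply/seteqP; split => t /=; rewrite in_itv/=.
  transitivity (\int[mu]_t (scaledE1 alpha (x - t) * g t)%:E)%E.
    apply: eq_integral => t _; case: ifPn => [/andP[at_ tx]|].
      rewrite Sop_rconv ?at_ ?(le_trans (ltW tx))// /scaledE1 -E1_gtail//.
      by rewrite divr_gt0// subr_gt0.
    rewrite negb_and -ltNge -leNgt => /orP[ta|xt]; first by rewrite g_lt// mulr0.
    by rewrite scaledE1_le0 ?mul0r// subr_le0.
  rewrite E; apply: eq_integral => r _; rewrite conv_scaledS_scaledE1// muleCA; congr (_ * _)%E.
  by rewrite /hstep subr_gt0; case: ifP => _; rewrite ?mule1 ?mule0.
rewrite /Jop /Rintegral J fineM//; last exact: integrable_fin_num.
rewrite /= mulKf ?gt_eqF// /primitive /Rintegral -integral_itv_bndo_bndc; last first.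
  by apply/measurable_EFinP; exact: measurable_funTS.
rewrite (@integral_mkif _ `]-oo, x[%classic (fun r => r < x)); last first.
  by apply/seteqP; split => t /=; rewrite in_itv/=.
by congr fine; apply: eq_integral => r _; case: ifP.
Qed.

Lemma is_ac_repr_primitive :
  is_ac_repr a b (Jop a alpha (Sop a alpha f)) (primitive fab).
Proof.
split; first by apply: abs_continuous_primitive; exact: integrable_restr.
by apply: aeW => x; rewrite in_itv/= => xab; rewrite Jop_Sop.
Qed.

(** The representative picked by [xget] is unspecified; uniqueness identifies it. *)
Lemma ac_repr_primitive x : a <= x < b ->
  ac_repr a b (Jop a alpha (Sop a alpha f)) x = primitive fab x.
Proof.
have [acG aeG] : is_ac_repr a b (Jop a alpha (Sop a alpha f))
    (ac_repr a b (Jop a alpha (Sop a alpha f))).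
  exact: (xgetPex _ (ex_intro _ _ is_ac_repr_primitive)).
have [acF _] := is_ac_repr_primitive.
apply: (abs_continuous_ae_eq acG acF).
move: aeG; apply: filterS; first exact: (ae_filter_ringOfSetsType mu).
by move=> y H yab; rewrite H// Jop_Sop//; move: yab; rewrite in_itv.
Qed.

Lemma ae_derive_ac_repr : {ae mu, forall x, x \in `[a, b] ->
  derivable (ac_repr a b (Jop a alpha (Sop a alpha f))) x 1 /\
  frac_derivative a b alpha (Sop a alpha f) x = f x}.
Proof.
have D : {ae mu, forall x,
    derivable (primitive fab) x 1 /\ (primitive fab)^`()%classic x = fab x}.
  apply: FTC1Ny => [y|]; first exact: integrable_itv integrable_restr.
  exact: open_integrable_locally openT integrable_restr.
(* The endpoints are discarded because [ac_repr] is arbitrary outside [a, b], while transferring the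
   derivative requires agreement in a neighbourhood of x. *)
have Na (c : R) : {ae mu, forall x, x != c}.
  exists [set c]; split; [exact: measurable_set1|exact: lebesgue_measure_set1|].
  by move=> x /= /negP; rewrite negbK => /eqP.
move: D (Na a) (Na b); apply: filterS3; first exact: (ae_filter_ringOfSetsType mu).
move=> x [dx Dx] xa xb; rewrite in_itv/= => /andP[ax xb'].
have xab : a < x < b by rewrite !lt_neqAle eq_sym xa ax xb xb'.
have nr : \forall y \near x, primitive fab y = ac_repr a b (Jop a alpha (Sop a alpha f)) y.
  have /andP[ax' xb''] := xab.
  near=> y; rewrite ac_repr_primitive//; apply/andP; split.
    by apply/ltW; near: y; exact: lt_nbhsr.
  by near: y; exact: lt_nbhsl.
split; first exact: near_eq_derivable nr dx.
rewrite /frac_derivative derive1E -(near_eq_derive _ nr) -derive1E Dx fabE//.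
by rewrite ax xb'.
Unshelve. all: by end_near. Qed.

End fractional_integrals.

(** The first two clauses and derivability ensure that the last equality involves no default value:
    otherwise [ac_repr] could fall back on its argument and [derive1] on a meaningless limit. *)
Theorem theorem4p3 (R : realType) (a b alpha : R) (f : R -> R) :
  a < b ->
  0 < alpha ->
  (@lebesgue_measure R).-integrable `[a, b] (EFin \o f) ->
  [/\ (@lebesgue_measure R).-integrable `[a, b] (EFin \o Sop a alpha f),
      has_ac_repr a b (Jop a alpha (Sop a alpha f)) &
      {ae (@lebesgue_measure R), forall x, x \in `[a, b] ->
        derivable (ac_repr a b (Jop a alpha (Sop a alpha f))) x 1 /\
        frac_derivative a b alpha (Sop a alpha f) x = f x}].
Proof.
move=> _ alpha0 intf; split; first exact: integrable_Sop.
- by exists (primitive (f \_ `[a, b])); exact: is_ac_repr_primitive.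
- exact: ae_derive_ac_repr.
Qed.
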